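(* Let $\pi$ be an order-$q$-subplane of $\mathrm{PG}(2,q^3)$ exterior to $\ell_\infty$, with exterior splash $\mathbb S$, conic cover $\mathbb C$, and tangent cover $\mathbb T$. 1. A $\pi$-pencil-subline of $\mathbb S$ corresponds in $\mathrm{PG}(6,q)$ to a 2-regulus that meets each plane of $\mathbb T$ in a distinct line, and meets each plane of $\mathbb C$ in a conic. 2. A $\pi$-dual-conic-subline of $\mathbb S$ corresponds in $\mathrm{PG}(6,q)$ to a 2-regulus that meets each plane of $\mathbb T$ in a conic, and meets each plane of $\mathbb C$ in a distinct line.
   Context: Let $q$ be a prime power, $\tau$ a primitive element of $\mathbb F_{q^3}$, and for $\alpha=a_0+a_1\tau+a_2\tau^2$ ($a_i\in\mathbb F_q$) write $[\alpha]=(a_0,a_1,a_2)$. Bruck-Bose correspondence: $\ell_\infty$ is the line $z=0$ of $\mathrm{PG}(2,q^3)$ and $\Sigma_\infty\cong\mathrm{PG}(5,q)$ is the hyperplane $z=0$ of $\mathrm{PG}(6,q)$, which has coordinates $(x_0,x_1,x_2,y_0,y_1,y_2,z)$. The affine point $(\alpha,\beta,1)$ corresponds to $([\alpha],[\beta],1)$. The point $L=(\alpha,\beta,0)$ of $\ell_\infty$ corresponds to the plane $[L]=\{([\alpha x],[\beta x],0): x\in\mathbb F_{q^3}\setminus\{0\}\}$. The planes $[L]$ form a regular 2-spread $\mathcal S$ of $\Sigma_\infty$. Order-$q$-subplanes of $\mathrm{PG}(2,q^3)$ are the images of $\mathrm{PG}(2,q)$ under $\mathrm{PGL}(3,q^3)$;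 order-$q$-sublines are lines of such subplanes, i.e. on $\ell_\infty$ the images of $\mathrm{PG}(1,q)$ under $\mathrm{PGL}(2,q^3)$. If $\pi$ is exterior to $\ell_\infty$ (no points on $\ell_\infty$), its exterior splash $\mathbb S$ is the set of $q^2+q+1$ points of $\ell_\infty$ on extended lines of $\pi$, and also the corresponding set of planes of $\mathcal S$. A 2-regulus is a set of $q+1$ mutually disjoint planes such that a line meeting three of them meets all. An order-$q$-subline $b$ of $\ell_\infty$ corresponds to the 2-regulus $[b]=\{[L]:L\in b\}$ of $\mathcal S$ (known). Covers: by a result of Bruck there are two sets of $q^2+q+1$ planes of $\Sigma_\infty$, the covers of $\mathbb S$. Planes in the same set are disjoint, $\mathbb S$ and both covers have the same union of points, and planes from different sets meet in exactly one point. They are named relative to $\pi$ as follows. Let $\mathscr B$ be the order-$q$-subplane that is the image of $\mathrm{PG}(2,q)$ under the homography with matrix (acting on column vectors) $$K=\begin{pmatrix}-\tau&1&0\\-\tau^q&1&0\\\tau\tau^q&-\tau-\tau^q&1\end{pmatrix}.$$ It is exterior to $\ell_\infty$, with splash $\{(k,1,0):k\in\mathscr K\}$, $\mathscr K=\{k\in\mathbb F_{q^3}: k^{q^2+q+1}=1\}$. Its tangent cover consists of the planes $[T_k]=\{([kx],[x^q],0):x\in\mathbb F_{q^3}\setminus\{0\}\}$, $k\in\mathscr K$, and its conic cover of the planes $[C_k]=\{([kx],[x^{q^2}],0):x\in\mathbb F_{q^3}\setminus\{0\}\}$, $k\in\mathscr K$. For a general exterior $\pi$, there is a homography $\phi:(x,y,z)\mapsto(ax+by+ez,\,cx+dy+fz,\,z)$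 of $\mathrm{PG}(2,q^3)$ fixing $\ell_\infty$ with $\phi(\mathscr B)=\pi$. The tangent cover $\mathbb T$ and conic cover $\mathbb C$ of $\pi$ are the images of those of $\mathscr B$ under the induced map $([x],[y],0)\mapsto([ax+by],[cx+dy],0)$ of $\Sigma_\infty$ (for one, equivalently any, such $\phi$). Sublines of $\mathbb S$: if $A$ is a point of $\pi$, the $q+1$ (extended) lines of $\pi$ through $A$ meet $\ell_\infty$ in an order-$q$-subline of $\mathbb S$, called a $\pi$-pencil-subline of $\mathbb S$. Let $m,n$ be the two conjugates of $\ell_\infty$ with respect to $\pi$ (its images under the two nontrivial collineations in the order-3 collineation group of $\mathrm{PG}(2,q^3)$ fixing $\pi$ pointwise). A $(\pi,\ell_\infty)$-special dual conic is a (non-degenerate) dual conic of $\pi$ whose extension to $\mathrm{PG}(2,q^3)$ contains the three lines $\ell_\infty,m,n$. The $q+1$ lines of $\pi$ in such a dual conic meet $\ell_\infty$ in an order-$q$-subline of $\mathbb S$, called a $\pi$-dual-conic-subline of $\mathbb S$. A plane $\alpha$ that meets the planes of a 2-regulus $\mathcal R$ in a set of $q+1$ points meets it in either a line or a (non-degenerate) conic of $\alpha$; this is abbreviated ''$\mathcal R$ meets $\alpha$ in a line'' or ''in a conic''. *)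

(* Defs.v *)
From HB Require Import structures.
From mathcomp Require Import all_boot all_order all_algebra all_field.
From mathcomp Require Import boolp classical_sets functions cardinality.

Set Implicit Arguments.
Unset Strict Implicit.
Unset Printing Implicit Defensive.

Import GRing.Theory.
Local Open Scope classical_set_scope.
Local Open Scope ring_scope.

(* The subspaces of the projective space PG(n-1,K) are the vector subspaces of
   K^n; points, lines and planes have vector space dimension 1, 2 and 3. The
   field F plays the role of F_q, with q = #|F|, and L that of F_{q^3}. *)

Section Projective.
Variables (K : fieldType) (V : vectType K).
Implicit Types (U W l : {vspace V}) (R : set {vspace V}).

Definition points_of U : set {vspace V} :=
  [set P | \dim P = 1%N /\ (P <= U)%VS].

Definition meets l U : Prop := (l :&: U)%VS <> 0%VS.

Definition two_regulus (q : nat) R : Prop :=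
  [/\ (R #= `I_q.+1)%card,
      (forall U, R U -> \dim U = 3%N),
      (forall U W, R U -> R W -> U <> W -> (U :&: W)%VS = 0%VS) &
      (forall l U1 U2 U3, \dim l = 2%N -> R U1 -> R U2 -> R U3 ->
         U1 <> U2 -> U1 <> U3 -> U2 <> U3 ->
         meets l U1 -> meets l U2 -> meets l U3 ->
         forall U, R U -> meets l U)].

(* the points of U lying on the members of R *)
Definition section_by R U : set {vspace V} :=
  [set P | points_of U P /\ exists2 W, R W & (P <= W)%VS].

Definition meets_in_distinct_lines R (T : set {vspace V}) : Prop :=
  exists ell : {vspace V} -> {vspace V},
    (forall U, T U -> [/\ \dim (ell U) = 2%N, (ell U <= U)%VS &
                          section_by R U = points_of (ell U)]) /\
    (forall U W, T U -> T W -> ell U = ell W -> U = W).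

End Projective.

Section Conics.
Variables (K : fieldType) (n : nat).
Implicit Types (A : 'M[K]_n) (U : {vspace 'rV[K]_n}) (u w : 'rV[K]_n).

(* A need not be symmetric, so every quadratic form is of this shape, also in
   characteristic 2. *)
Definition qform A u : K := (u *m A *m u^T) 0 0.

(* The quadratic form has no singular vector in U. Over a finite field this is
   the non-degeneracy of a conic in every characteristic. *)
Definition nondegenerate_on A U : Prop :=
  forall u, u \in U -> qform A u = 0 ->
    (forall w, w \in U -> qform A (u + w) = qform A u + qform A w) -> u = 0.

Definition conic_of_plane U (X : set {vspace 'rV[K]_n}) : Prop :=
  \dim U = 3%N /\
  exists2 A, nondegenerate_on A U &
    X = [set <[u]>%VS | u in [set u | [/\ u \in U, u != 0 & qform A u = 0]]].

Definition meets_in_conics (R T : set {vspace 'rV[K]_n}) : Prop :=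
  forall U, T U -> conic_of_plane U (section_by R U).

End Conics.

Section PG2.
Variables (F : finFieldType) (L : fieldExtType F).
Implicit Types (M : 'M[L]_3) (pi b : set {vspace 'cV[L]_3}).
Implicit Types (l : {vspace 'cV[L]_3}).

Definition homography M (U : {vspace 'cV[L]_3}) : {vspace 'cV[L]_3} :=
  (linfun (mulmx M) @: U)%VS.

(* the line of PG(2,q^3) with dual coordinates u *)
Definition line_of (u : 'rV[L]_3) : {vspace 'cV[L]_3} :=
  lker (linfun (mulmx u : 'cV[L]_3 -> 'cV[L]_1)).

Definition PG2q : set {vspace 'cV[L]_3} :=
  [set <[map_mx (in_alg L) v]>%VS | v in [set v : 'cV[F]_3 | v != 0]].

Definition order_q_subplane pi : Prop :=
  exists2 M, M \in unitmx & pi = homography M @` PG2q.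

(* the line z = 0 *)
Definition linf : {vspace 'cV[L]_3} := line_of (delta_mx 0 ord_max).

Definition exterior pi : Prop := forall P, pi P -> ~~ (P <= linf)%VS.

Definition line_of_subplane pi l : Prop :=
  \dim l = 2%N /\
  exists P Q, [/\ pi P, pi Q, P <> Q, (P <= l)%VS & (Q <= l)%VS].

Definition splash pi : set {vspace 'cV[L]_3} :=
  [set P | points_of linf P /\ exists2 l, line_of_subplane pi l & (P <= l)%VS].

Definition pencil_subline pi b : Prop :=
  exists2 A, pi A &
    b = [set P | splash pi P /\
                 exists l, [/\ line_of_subplane pi l, (A <= l)%VS & (P <= l)%VS]].

Definition collineation (g : {vspace 'cV[L]_3} -> {vspace 'cV[L]_3}) : Prop :=
  bijective g /\ forall U W, (g U <= g W)%VS = (U <= W)%VS.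

(* The collineations fixing pi pointwise form a group of order 3. *)
Definition conjugates_of_linf pi : set {vspace 'cV[L]_3} :=
  [set m | exists g, [/\ collineation g, (forall P, pi P -> g P = P),
                         (exists U, g U <> U) & m = g linf]].

(* D is a non-degenerate dual conic of pi, given as a set of (extended) lines
   of pi, and E is its extension to PG(2,q^3). *)
Definition dual_conic_with_extension pi (D E : set {vspace 'cV[L]_3}) : Prop :=
  exists (M : 'M[L]_3) (A : 'M[F]_3),
    [/\ M \in unitmx, pi = homography M @` PG2q, nondegenerate_on A fullv,
        D = [set homography M (line_of (map_mx (in_alg L) u))
              | u in [set u : 'rV[F]_3 | u != 0 /\ qform A u = 0]] &
        E = [set homography M (line_of u)
              | u in [set u : 'rV[L]_3 |
                       u != 0 /\ qform (map_mx (in_alg L) A) u = 0]]].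

Definition special_dual_conic pi (D : set {vspace 'cV[L]_3}) : Prop :=
  exists E, [/\ dual_conic_with_extension pi D E, E linf &
                conjugates_of_linf pi `<=` E].

Definition dual_conic_subline pi b : Prop :=
  exists2 D, special_dual_conic pi D &
    b = [set P | splash pi P /\ exists2 l, D l & (P <= l)%VS].

End PG2.

Section BruckBose.
Variables (F : finFieldType) (L : fieldExtType F) (tau : L).
Local Notation q := #|F|.
Local Notation PG6 := {vspace 'rV[F]_(3 + 3 + 1)}.

Definition bracket (x : L) : 'rV[F]_3 :=
  \row_i coord [tuple 1; tau; tau ^+ 2] i x.

Definition unbracket (v : 'rV[F]_3) : L := \sum_(i < 3) v 0 i *: tau ^+ i.

(* the vector ([x], [y], 0) *)
Definition bb_vec (x y : L) : 'rV[F]_(3 + 3 + 1) :=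
  row_mx (row_mx (bracket x) (bracket y)) 0.

(* The plane {([f x], [g x], 0) : x}, for F-linear f and g. *)
Definition sigma_plane (f g : L -> L) : PG6 :=
  limg (linfun (fun x => bb_vec (f x) (g x))).

Definition spread_plane (a b : L) : PG6 :=
  sigma_plane (fun x => a * x) (fun x => b * x).

Definition tangent_plane (k : L) : PG6 :=
  sigma_plane (fun x => k * x) (fun x => x ^+ q).

Definition conic_plane (k : L) : PG6 :=
  sigma_plane (fun x => k * x) (fun x => x ^+ (q ^ 2)).

Definition col3 (x y z : L) : 'cV[L]_3 := \col_i nth 0 [:: x; y; z] i.

Definition mx3 (s : seq (seq L)) : 'M[L]_3 :=
  \matrix_(i, j) nth 0 (nth [::] s i) j.

Definition bb_set (b : set {vspace 'cV[L]_3}) : set PG6 :=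
  [set U | exists x y : L, b <[col3 x y 0]>%VS /\ U = spread_plane x y].

Definition Kmx : 'M[L]_3 :=
  mx3 [:: [:: - tau; 1; 0];
          [:: - tau ^+ q; 1; 0];
          [:: tau * tau ^+ q; - tau - tau ^+ q; 1]].

Definition Bplane : set {vspace 'cV[L]_3} := homography Kmx @` @PG2q F L.

Definition normK : set L := [set k | k ^+ (q ^ 2 + q + 1) = 1].

(* the map ([x], [y], 0) |-> ([a x + b y], [c x + d y], 0) *)
Definition induced (a b c d : L) : 'End('rV[F]_(3 + 3 + 1)) :=
  linfun (fun v : 'rV[F]_(3 + 3 + 1) =>
    let x := unbracket (lsubmx (lsubmx v)) in
    let y := unbracket (rsubmx (lsubmx v)) in
    bb_vec (a * x + b * y) (c * x + d * y)).

Definition cover_of (plane : L -> PG6) (pi : set {vspace 'cV[L]_3})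
    (T : set PG6) : Prop :=
  exists a b c d e f : L,
    let Phi := mx3 [:: [:: a; b; e]; [:: c; d; f]; [:: 0; 0; 1]] in
    [/\ Phi \in unitmx, homography Phi @` Bplane = pi &
        T = [set (induced a b c d @: plane k)%VS | k in normK]].

Definition tangent_cover := cover_of tangent_plane.
Definition conic_cover := cover_of conic_plane.

(* Since linfun does not check linearity, the next lemmas record that it is
   only applied to linear maps, and which sets the planes are. *)

Lemma bracket_linear : linear bracket.
Proof. by move=> a x y; apply/rowP=> i; rewrite !mxE linearP. Qed.

Lemma unbracket_linear : linear unbracket.
Proof.
move=> a u v; rewrite /unbracket scaler_sumr -big_split; apply: eq_bigr => i _.
by rewrite !mxE scalerDl scalerA.
Qed.

Lemma bb_vec_linear a x y x' y' :
  bb_vec (a *: x + x') (a *: y + y') = a *: bb_vec x y + bb_vec x' y'.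
Proof.
by rewrite /bb_vec !bracket_linear !scale_row_mx !add_row_mx scaler0 addr0.
Qed.

Lemma frobenius_linear : linear (fun x : L => x ^+ q).
Proof.
have [p p_pr charF] := finPcharP F.
have charL : p \in [pchar L] by rewrite pchar_lalg.
have qE : [pchar L].-nat q.
  rewrite (eq_pnat _ (pcharf_eq charL)) (card_pprimeChar charF).
  by rewrite pnatX pnat_id.
move=> a x y; rewrite exprDn_pchar //; congr (_ + _).
by rewrite exprZn expf_card.
Qed.

Lemma frobenius2_linear : linear (fun x : L => x ^+ (q ^ 2)).
Proof. by move=> a x y; rewrite expnS expn1 !exprM !frobenius_linear. Qed.

Lemma linfun_linE (aT rT : vectType F) (f : aT -> rT) :
  linear f -> linfun f =1 f.
Proof.
move=> fL x; pose ff := HB.pack_for {linear aT -> rT} f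
  (GRing.isLinear.Build F aT rT *:%R f fL).
exact: (lfunE ff).
Qed.

Lemma mem_sigma_plane (f g : L -> L) (v : 'rV[F]_(3 + 3 + 1)) :
    linear f -> linear g ->
  v \in sigma_plane f g <-> exists x, v = bb_vec (f x) (g x).
Proof.
move=> fL gL; have hL : linear (fun x => bb_vec (f x) (g x)).
  by move=> a x y; rewrite fL gL bb_vec_linear.
split=> [/memv_imgP[x _ ->]|[x ->]]; first by exists x; rewrite linfun_linE.
by apply/memv_imgP; exists x; rewrite ?memvf ?linfun_linE.
Qed.

Lemma mulr_linear (a : L) : linear (fun x => a * x : L).
Proof. by move=> c x y; rewrite mulrDr scalerAr. Qed.

Lemma mem_spread_plane a b v :
  v \in spread_plane a b <-> exists x, v = bb_vec (a * x) (b * x).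
Proof. exact: mem_sigma_plane (mulr_linear a) (mulr_linear b). Qed.

Lemma mem_tangent_plane k v :
  v \in tangent_plane k <-> exists x, v = bb_vec (k * x) (x ^+ q).
Proof. exact: mem_sigma_plane (mulr_linear k) frobenius_linear. Qed.

Lemma mem_conic_plane k v :
  v \in conic_plane k <-> exists x, v = bb_vec (k * x) (x ^+ (q ^ 2)).
Proof. exact: mem_sigma_plane (mulr_linear k) frobenius2_linear. Qed.

Lemma inducedE a b c d v :
  induced a b c d v =
    let x := unbracket (lsubmx (lsubmx v)) in
    let y := unbracket (rsubmx (lsubmx v)) in
    bb_vec (a * x + b * y) (c * x + d * y).
Proof.
apply: linfun_linE => t u w; rewrite !linearP !unbracket_linear -bb_vec_linear.
by congr bb_vec; rewrite !mulrDr -!scalerAr scalerDr addrACA.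
Qed.

End BruckBose.

(* Main.v *)
Require Import Defs.
From HB Require Import structures.
From mathcomp Require Import all_boot all_order all_algebra all_field.
From mathcomp Require Import boolp classical_sets functions cardinality.
From mathcomp Require Import ring.

(** Write q for the order of F, theta for the q-th power map of L, and let s be
    either theta or theta^2, the two nontrivial automorphisms of L over F. For
    nonzero c put
        R(s,c) = { {(w x, s(w) x) : x in L} : w <> 0, tr(c w) = 0 }.
    Everything follows from three facts about R(s,c), all up to an injective
    linear map J of L x L.

    - R(s,c) is a 2-regulus ([subline_two_regulus]): a line meeting three of its
      members is the set of (w x, s(w) x) with x fixed and tr(c w) = 0.
    - By Hilbert's theorem 90 a plane {(k x, s(x))} with k of norm 1 is also
      {(w y, s(w) y)} for some fixed y <> 0, and its point of parameter w lies on
      the spread element of parameter w. So R(s,c) cuts this plane in the line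
      tr(c w) = 0 ([cover_meets_in_lines]).
    - A plane {(k x, s^2(x))} with k of norm 1 is likewise {(u z, s^2(u) z)}, and
      its point of parameter u lies on the member of R(s,c) of parameter
      w = u s(u). So R(s,c) cuts this plane in tr(c u s(u)) = 0, a conic which
      is nondegenerate in every characteristic ([cover_sqr_meets_in_conics]).

    The planes {(k x, s(x))} and {(k x, s^2(x))} form the tangent and the conic
    cover if s = theta, and the conic and the tangent cover if s = theta^2. It
    remains to see that the pencil-sublines are the R(theta,c) and that the
    dual-conic-sublines are some R(theta^2,c).

    A line u of PG(2,q) has the parameter m = u0 + u1 tau + u2 tau^2, and the
    corresponding line of the standard subplane meets the line at infinity in
    (m, theta(m), 0) ([incidence]). Lagrange interpolation at the three
    conjugates of tau recovers the coordinates of u as traces of multiples of m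
    ([lagrangeE]). Hence passing through a fixed point reads tr(c m) = 0
    ([mulmx_trace]), which gives R(theta,c). In the same coordinates a quadratic
    form over F is tr(a m^2 + c m theta(m)), and a = 0 as soon as the form
    vanishes on the line at infinity ([qform_trace]); so a special dual conic
    reads tr(c m theta(m)) = 0. Rescaling (m, theta(m)) by theta^2(m) gives
    (w, theta^2(w)) with w = m theta^2(m), and the condition becomes
    tr(theta^2(c) w) = 0 ([bb_dual_conic_subline]), which gives R(theta^2,c').

    The dual conic may be presented in a frame other than the one that defines
    the covers; two frames of a subplane differ by a scalar and a matrix over F
    ([subplane_frame]). *)

Set Implicit Arguments.
Unset Strict Implicit.
Unset Printing Implicit Defensive.

Import GRing.Theory.
Local Open Scope classical_set_scope.
Local Open Scope ring_scope.

(** * Vector spaces of small dimension *)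

Section VectorSpaces.
Variables (K : fieldType) (vT : vectType K).
Implicit Types (U W P : {vspace vT}) (u v w : vT).

Lemma dim1P P : \dim P = 1%N <-> exists2 p, p != 0 & P = <[p]>%VS.
Proof.
split=> [dP|[p p0 ->]]; last by rewrite dim_vline p0.
have p0 : vpick P != 0 by rewrite vpick0 -dimv_eq0 dP.
exists (vpick P) => //; apply/esym/eqP.
by rewrite eqEdim dim_vline p0 dP leqnn andbT -memvE memv_pick.
Qed.

Lemma meetsP U W : Defs.meets U W <-> exists v, [/\ v != 0, v \in U & v \in W].
Proof.
split=> [/eqP|[v [v0 vU vW]] UW0]; last first.
  have : v \in (U :&: W)%VS by rewrite memv_cap vU.
  by rewrite UW0 memv0 (negbTE v0).
rewrite -vpick0 => v0; exists (vpick (U :&: W)); split=> //;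
by have := memv_pick (U :&: W); rewrite memv_cap => /andP[].
Qed.

Lemma dim2_span U u v w : \dim U = 2%N -> u \in U -> v \in U ->
  u != 0 -> v \notin <[u]>%VS -> w \in U -> exists f g, w = f *: u + g *: v.
Proof.
move=> dU uU vU u0 uv; suff -> : U = (<[u]> + <[v]>)%VS.
  move=> /memv_addP[_ /vlineP[f ->] [_ /vlineP[g ->] ->]].
  by exists f, g.
apply/esym/eqP; rewrite eqEdim subv_add -!memvE uU vU dU /= dimv_disjoint_sum.
  rewrite !dim_vline u0; case: eqP uv => // ->; by rewrite mem0v.
apply/eqP; rewrite -subv0; apply/subvP => x; rewrite memv_cap memv0.
case/andP=> /vlineP[f ->] /vlineP[g e]; apply: contraR uv => fu0.
apply/vlineP; exists (g^-1 * f); rewrite -scalerA e scalerA mulVf ?scale1r //.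
by apply: contra fu0 => /eqP g0; rewrite e g0 scale0r.
Qed.

Lemma dim2_pair U : \dim U = 2%N ->
  exists u v, [/\ u \in U, v \in U, u != 0 & v \notin <[u]>%VS].
Proof.
move=> dU; have u0 : vpick U != 0 by rewrite vpick0 -dimv_eq0 dU.
have /subvPn[v vU uv] : ~~ (U <= <[vpick U]>)%VS.
  by apply/negP => /dimvS; rewrite dU dim_vline u0.
by exists (vpick U), v; split=> //; apply: memv_pick.
Qed.

End VectorSpaces.

Lemma card_eq_finType (T : finType) : ([set: T] #= `I_#|T|)%card.
Proof.
have -> : [set: T] = (@enum_val T T) @` [set: 'I_#|T|].
  apply/seteqP; split=> // x _; exists (enum_rank x) => //; exact: enum_rankK.
apply: card_eq_trans (inj_card_eq _) _; first by move=> x y _ _ /enum_val_inj.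
by rewrite card_eq_sym card_II.
Qed.

(** * Automorphisms of order three and their trace *)

Section CubicAutomorphism.
Variables (F : finFieldType) (L : fieldExtType F).

(** The automorphism is kept abstract so that every result about it applies both
    to the Frobenius map and to its square. *)
Definition cubic_automorphism (s : {lrmorphism L -> L}) : Prop :=
  [/\ forall x, s (s (s x)) = x,
      forall x, s x = x -> exists f : F, x = f%:A &
      exists x, s x <> x].

Lemma cubic_automorphism_sqr s :
  cubic_automorphism s -> cubic_automorphism (s \o s).
Proof.
case=> s3 fixF [a sa]; split=> /=; first by move=> x; rewrite !s3.
- by move=> x ssx; apply: fixF; rewrite -{1}ssx s3.
by exists a => ssa; apply: sa; rewrite -{1}ssa s3.
Qed.

Variable s : {lrmorphism L -> L}.
Hypothesis cub : cubic_automorphism s.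

Let s3 x : s (s (s x)) = x. Proof. by case: cub. Qed.

Lemma fixed_scalar x : s x = x -> exists f : F, x = f%:A.
Proof. by case: cub => _ h _; apply: h. Qed.

Lemma automorph_neq0 x : x != 0 -> s x != 0.
Proof. by rewrite fmorph_eq0. Qed.

(** Dedekind independence of 1, s and s^2: the three equations obtained from
    z = 1, a, a^2 with a moved by s form a Vandermonde system. *)
Lemma cubic_independent m n : n != 0 -> exists z, z + m * s z + n * s (s z) != 0.
Proof.
move=> n0; case: cub => _ _ [a sa]; apply: contrapT => no.
have zero z : z + m * s z + n * s (s z) = 0.
  by apply: contrapT => /eqP nz; apply: no; exists z.
have ssa : s (s a) <> s a by move/fmorph_inj.
have ssa' : s (s a) <> a by move=> h; apply: sa; rewrite -{1}h s3.
have : n * (s (s a) - a) * (s (s a) - s a) != 0.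
  by rewrite !mulf_neq0 // subr_eq0; apply/eqP.
move/eqP; apply; have := zero (a * a); have := zero a; have := zero 1.
rewrite !rmorph1 !rmorphM => h1 ha haa.
(* Evaluating (X - a)(X - s a) at the conjugates leaves only the term in n. *)
transitivity ((a * a + m * (s a * s a) + n * (s (s a) * s (s a)))
  - (a + s a) * (a + m * s a + n * s (s a)) + a * s a * (1 + m * 1 + n * 1)).
  by ring.
by rewrite h1 ha haa; ring.
Qed.

(** The usual resolvent z + s(z)/k + s^2(z)/(k s(k)) solves the equation, and
    independence provides a z for which it does not vanish. *)
Lemma cubic_Hilbert90 k :
  k * s k * s (s k) = 1 -> exists2 y, y != 0 & s y = y * k.
Proof.
move=> Nk; have k0 : k != 0.
  by apply/eqP=> k0; move/eqP: Nk; rewrite k0 !mul0r eq_sym oner_eq0.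
have sk0 := automorph_neq0 k0; have ssk0 := automorph_neq0 sk0.
have kE : k = (s k * s (s k))^-1.
  by apply: (mulIf (mulf_neq0 sk0 ssk0)); rewrite mulVf ?mulf_neq0 // -Nk; ring.
have n0 : (k * s k)^-1 != 0 by rewrite invr_eq0 mulf_neq0.
have [z nz] := cubic_independent (k^-1) n0.
exists (z + k^-1 * s z + (k * s k)^-1 * s (s z)) => //.
rewrite !rmorphD !rmorphM !fmorphV !rmorphM /= s3 -kE.
by field; rewrite k0 sk0.
Qed.

Definition trace x := x + s x + s (s x).

Lemma trace_linear c : linear (fun x => trace (c * x)).
Proof.
move=> f x y; rewrite /trace -(mulr_algl f x) -(mulr_algl f (trace _)) /trace.
by rewrite !(rmorphD, rmorphM) /= !rmorph_alg; ring.
Qed.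

Lemma trace_fixed x : s (trace x) = trace x.
Proof. by rewrite /trace !rmorphD /= s3; ring. Qed.

Lemma traceZ (f : F) x : trace (f *: x) = f *: trace x.
Proof.
rewrite -(mulr_algl f x) -(mulr_algl f (trace x)) /trace.
by rewrite !rmorphM /= !rmorph_alg; ring.
Qed.

Lemma trace_shift x : trace (s x) = trace x.
Proof. by rewrite /trace s3; ring. Qed.

Definition trace_kernel c : {vspace L} :=
  lker (linfun (fun x => trace (c * x) : L)).

Lemma mem_trace_kernel c x : (x \in trace_kernel c) = (trace (c * x) == 0).
Proof. by rewrite memv_ker linfun_linE //; apply: trace_linear. Qed.

Lemma dim_trace_kernel c : \dim {:L} = 3%N -> c != 0 ->
  \dim (trace_kernel c) = 2%N.
Proof.
move=> dimL c0; set f := linfun (fun x => trace (c * x) : L).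
have fE : f =1 fun x => trace (c * x) by apply/linfun_linE/trace_linear.
have dimf := limg_ker_dim f fullv; rewrite capfv dimL in dimf.
suff dim1 : \dim (limg f) = 1%N by move: dimf; rewrite dim1 addn1 => -[].
suff -> : limg f = <[1]>%VS by rewrite dim_vline oner_eq0.
apply/eqP; rewrite eqEdim dim_vline oner_eq0 /=; apply/andP; split.
  apply/subvP=> _ /memv_imgP[x _ ->]; rewrite fE.
  by have [g ->] := fixed_scalar (trace_fixed (c * x)); apply/memvZ/memv_line.
rewrite lt0n dimv_eq0; apply/negP => /eqP img0.
have [z] := cubic_independent 1 (oner_neq0 L).
rewrite !mul1r => /negP; apply.
have : f (c^-1 * z) \in limg f by apply: memv_img; apply: memvf.
by rewrite img0 memv0 fE mulVKf.
Qed.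

End CubicAutomorphism.

(** * Sublines and covers attached to an automorphism *)

Section Model.
Variables (F : finFieldType) (L : fieldExtType F) (n : nat).
Hypothesis dimL : \dim {:L} = 3%N.
Variable J : L -> L -> 'rV[F]_n.
Hypothesis J_linear : forall (f : F) x y x' y',
  J (f *: x + x') (f *: y + y') = f *: J x y + J x' y'.
Hypothesis J_eq0 : forall x y, J x y = 0 -> x = 0 /\ y = 0.

Lemma J0 : J 0 0 = 0.
Proof. by have := J_linear (- 1) 0 0 0 0; rewrite scaler0 addr0 scaleN1r addNr. Qed.

Lemma JZ f x y : J (f *: x) (f *: y) = f *: J x y.
Proof. by have := J_linear f x y 0 0; rewrite J0 !addr0. Qed.

Lemma JD x y x' y' : J (x + x') (y + y') = J x y + J x' y'.
Proof. by have := J_linear 1 x y x' y'; rewrite !scale1r. Qed.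

Lemma J_inj x y x' y' : J x y = J x' y' -> x = x' /\ y = y'.
Proof.
move=> e; have [] := @J_eq0 (- 1 *: x' + x) (- 1 *: y' + y).
  by rewrite J_linear e scaleN1r addNr.
by rewrite !scaleN1r !(addrC (- _)) => /subr0_eq -> /subr0_eq ->.
Qed.

(** With J the Bruck-Bose map this is the plane of all ([f x], [g x], 0); in
    general J is that map followed by the action of a homography on the hyperplane
    at infinity. *)
Definition graph (f g : L -> L) : {vspace 'rV[F]_n} :=
  limg (linfun (fun x => J (f x) (g x))).

Section Graph.
Variables f g : L -> L.
Hypotheses (f_linear : linear f) (g_linear : linear g).

Lemma graph_linear : linear (fun x => J (f x) (g x)).
Proof. by move=> t x y; rewrite f_linear g_linear J_linear. Qed.

Lemma mem_graph v : v \in graph f g <-> exists x, v = J (f x) (g x).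
Proof.
split=> [/memv_imgP[x _ ->]|[x ->]].
  by exists x; rewrite (linfun_linE graph_linear).
by apply/memv_imgP; exists x; rewrite ?memvf ?(linfun_linE graph_linear).
Qed.

Lemma dim_graph : injective g -> \dim (graph f g) = 3%N.
Proof.
move=> g_inj; rewrite limg_dim_eq // capfv; apply/eqP/lker0P => x y.
by rewrite !(linfun_linE graph_linear) => /J_inj[_ /g_inj].
Qed.

End Graph.

Variable s : {lrmorphism L -> L}.
Hypothesis cub : cubic_automorphism s.
Let s3 x : s (s (s x)) = x. Proof. by case: cub. Qed.

Definition spread_member (w : L) := graph ( *%R w) ( *%R (s w)).

(** The set R(s,c) of the introduction. *)
Definition subline_regulus (c : L) : set {vspace 'rV[F]_n} :=
  [set spread_member w | w in [set w | w != 0 /\ trace s (c * w) = 0]].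

Lemma mem_spread_member w v :
  v \in spread_member w <-> exists x, v = J (w * x) (s w * x).
Proof. exact: mem_graph (mulr_linear w) (mulr_linear (s w)) v. Qed.

Lemma dim_spread_member w : w != 0 -> \dim (spread_member w) = 3%N.
Proof.
move=> w0; apply: (dim_graph (mulr_linear w) (mulr_linear (s w))).
by apply: mulfI; rewrite fmorph_eq0.
Qed.

(** The hypothesis says that w / w' is fixed by s. *)
Lemma eq_ratio w w' : w' != 0 -> w * s w' = s w * w' ->
  exists f : F, w = f *: w'.
Proof.
move=> w0 e; have sw0 := automorph_neq0 s w0.
have [|f fE] := fixed_scalar (x := w / w') cub.
  by rewrite rmorphM fmorphV /=; apply/eqP; rewrite eqr_div // -e.
by exists f; rewrite -mulr_algl -fE mulfVK.
Qed.

(** Dividing the two equations gives w / w' = s(w / w'); so spread elements with a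
    common point have proportional parameters. *)
Lemma spread_member_overlap w w' x x' : x != 0 -> w' != 0 ->
  w * x = w' * x' -> s w * x = s w' * x' -> exists f : F, w = f *: w'.
Proof.
move=> x0 w0 e1 e2; apply: eq_ratio => //; apply: (mulIf x0).
have x'E : x' = w * x / w' by rewrite e1 mulrAC mulfV // mul1r.
by rewrite [RHS]mulrAC e2 x'E; field.
Qed.

Lemma spread_memberZ (f : F) w : f != 0 ->
  spread_member (f *: w) = spread_member w.
Proof.
move=> f0; apply/vspaceP => v; apply/idP/idP => /mem_spread_member[x ->];
  apply/mem_spread_member.
  by exists (f *: x); rewrite linearZ_LR /= -!scalerAl -!scalerAr.
exists (f^-1 *: x); rewrite linearZ_LR /= -!scalerAl -!scalerAr !scalerA.
by rewrite mulfV // !scale1r.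
Qed.

Lemma cap_spread_member w w' : w' != 0 ->
  (spread_member w :&: spread_member w')%VS != 0%VS ->
  exists f : F, w = f *: w'.
Proof.
rewrite -vpick0 => w0; set v := vpick _ => v0.
have := memv_pick (spread_member w :&: spread_member w')%VS.
rewrite memv_cap => /andP[/mem_spread_member[x e] /mem_spread_member[x' e']].
have [] := J_inj (etrans (esym e) e'); apply: spread_member_overlap => //.
by apply: contra v0 => /eqP x0; rewrite /v e x0 !mulr0 J0.
Qed.

Lemma eq_spread_member w w' v : w != 0 -> w' != 0 -> v != 0 ->
  v \in spread_member w -> v \in spread_member w' ->
  spread_member w = spread_member w'.
Proof.
move=> w0 w0' v0 vw vw'; have [|f wE] := @cap_spread_member w w' w0'.
  by apply/eqP/meetsP; exists v.
rewrite wE spread_memberZ //; apply: contra w0 => /eqP f0.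
by rewrite wE f0 scale0r.
Qed.

Lemma spread_member_line w w' : w != 0 -> w' \in <[w]>%VS -> w' != 0 ->
  spread_member w' = spread_member w.
Proof.
move=> w0 /vlineP[f ->]; rewrite scaler_eq0 negb_or => /andP[f0 _].
exact: spread_memberZ.
Qed.

Lemma spread_member_inj w w' : w' != 0 ->
  spread_member w = spread_member w' -> exists f : F, w = f *: w'.
Proof.
move=> w0 e; apply: cap_spread_member => //.
by rewrite e capvv -dimv_eq0 dim_spread_member.
Qed.

(** The members are parametrised by the points of the projective line of the
    2-space tr(c w) = 0, that is, by h and by the vectors k + f h for f in F. *)
Lemma card_subline_regulus c : c != 0 ->
  (subline_regulus c #= `I_(#|F|).+1)%card.
Proof.
move=> c0; have dH := dim_trace_kernel cub dimL c0.
set H := trace_kernel s c in dH.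
have memH w : w \in H -> trace s (c * w) = 0.
  by rewrite mem_trace_kernel // => /eqP.
have [h [k [hH kH h0 kh]]] := dim2_pair dH.
have k0 : k != 0 by apply: contra kh => /eqP ->; rewrite mem0v.
pose dir o := if o is Some f then k + f *: h else h : L.
have dir0 o : dir o != 0.
  case: o => [f|] //=; apply: contra kh; rewrite addr_eq0 => /eqP ->.
  by rewrite -scaleNr; apply/memvZ/memv_line.
have -> : subline_regulus c = (fun o => spread_member (dir o)) @` [set: option F].
  apply/seteqP; split=> [_ [w [w0 wc] <-]|_ [o _ <-]]; last first.
    exists (dir o) => //; split=> //; apply: memH.
    by case: o => [f|] //=; apply/memvD/memvZ.
  have wH : w \in H by rewrite mem_trace_kernel // wc.
  have [f [g wE]] := dim2_span dH hH kH h0 kh wH.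
  have [g0|g0] := eqVneq g 0.
    exists None => //=; apply/esym/spread_member_line => //.
    by rewrite wE g0 scale0r addr0; apply/memvZ/memv_line.
  exists (Some (f / g)) => //; apply/esym/spread_member_line => //=.
    exact: (dir0 (Some _)).
  apply/vlineP; exists g; rewrite wE scalerDr scalerA addrC.
  by rewrite mulrCA mulfV // mulr1.
apply: card_eq_trans (inj_card_eq _) _; last first.
  by rewrite -card_option; apply: card_eq_finType.
move=> [f|] [g|] _ _ /(spread_member_inj (dir0 _))[t] //=.
- move/eqP; rewrite scalerDr -subr_eq0 opprD addrACA -[X in X - t *: k]scale1r.
  rewrite -scalerBl scalerA -scalerBl.
  have [->|t1] := eqVneq t 1.
    rewrite subrr scale0r add0r mul1r scaler_eq0 subr_eq0 (negbTE h0) orbF.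
    by move/eqP->.
  rewrite addr_eq0 => /eqP e; case/negP: kh.
  rewrite -subr_eq0 -opprB oppr_eq0 in t1.
  rewrite -[k]scale1r -(mulVf t1) -scalerA e -scaleNr.
  by do 2!apply/memvZ; apply/memv_line.
- move=> e; case/negP: kh.
  have -> : k = t *: h - f *: h by rewrite -e addrK.
  by rewrite -scalerBl; apply/memvZ/memv_line.
move=> e; have [t0|t0] := eqVneq t 0; first by case/eqP: h0; rewrite e t0 scale0r.
case/negP: kh; have -> : k = t^-1 *: h - g *: h.
  by rewrite e scalerA mulVf // scale1r -e addrK.
by rewrite -scalerBl; apply/memvZ/memv_line.
Qed.

(** The points v1, v2, v3 where l meets the three members are dependent, and so
    are the parameters w1, w2, w3. Comparing the two dependencies through the
    nonzero determinant w1 s(w2) - s(w1) w2 shows that x1, x2, x3 agree up to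
    scalars from F; so l consists of the points (w x3, s(w) x3) and meets all
    members. *)
Lemma subline_regulus_transversal c l U1 U2 U3 : c != 0 -> \dim l = 2%N ->
    subline_regulus c U1 -> subline_regulus c U2 -> subline_regulus c U3 ->
    U1 <> U2 -> U1 <> U3 -> U2 <> U3 ->
    Defs.meets l U1 -> Defs.meets l U2 -> Defs.meets l U3 ->
  forall U, subline_regulus c U -> Defs.meets l U.
Proof.
move=> c0 dl [w1 [w10 w1c] <-] [w2 [w20 w2c] <-] [w3 [w30 w3c] <-] n12 n13 n23.
move=> /meetsP[v1 [v10 v1l v1w]] /meetsP[v2 [v20 v2l v2w]].
move=> /meetsP[v3 [v30 v3l v3w]] _ [w [w0 wc] <-].
have dH := dim_trace_kernel cub dimL c0.
have memH x : trace s (c * x) = 0 -> x \in trace_kernel s c.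
  by rewrite mem_trace_kernel // => ->.
have w12 : w2 \notin <[w1]>%VS.
  by apply/negP => h; apply: n12; rewrite (@spread_member_line w1 w2).
have v12 : v2 \notin <[v1]>%VS.
  apply/negP => /vlineP[f v2E]; apply: n12.
  by apply: (@eq_spread_member _ _ v2) => //; rewrite v2E memvZ.
have [a [b v3E]] := dim2_span dl v1l v2l v10 v12 v3l.
have wE x (xc : trace s (c * x) = 0) :=
  dim2_span dH (memH _ w1c) (memH _ w2c) w10 w12 (memH _ xc).
have [f [g w3E]] := wE w3 w3c.
have f0 : f != 0.
  apply/eqP=> f0; apply: n23; apply/esym/spread_member_line => //.
  by rewrite w3E f0 scale0r add0r memvZ // memv_line.
have g0 : g != 0.
  apply/eqP=> g0; apply: n13; apply/esym/spread_member_line => //.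
  by rewrite w3E g0 scale0r addr0 memvZ // memv_line.
have /mem_spread_member[x1 v1J] := v1w; have /mem_spread_member[x2 v2J] := v2w.
have /mem_spread_member[x3 v3J] := v3w.
have x30 : x3 != 0 by apply: contra v30 => /eqP x0; rewrite v3J x0 !mulr0 J0.
have det0 : w1 * s w2 - s w1 * w2 != 0.
  rewrite subr_eq0; apply/eqP => /(eq_ratio w20)[t w1E]; case/negP: w12.
  apply/vlineP; exists t^-1; rewrite w1E scalerA mulVf ?scale1r //.
  by apply: contra w10 => /eqP t0; rewrite w1E t0 scale0r.
have [e1 e2] : w3 * x3 = w1 * (a *: x1) + w2 * (b *: x2) /\
               s w3 * x3 = s w1 * (a *: x1) + s w2 * (b *: x2).
  by apply: J_inj; rewrite JD -!scalerAr !JZ -v1J -v2J -v3J.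
have e1' : w1 * (f *: x3 - a *: x1) + w2 * (g *: x3 - b *: x2) = 0.
  rewrite !mulrBr addrACA -opprD -e1 w3E mulrDl -!scalerAl -!scalerAr.
  by rewrite subrr.
have e2' : s w1 * (f *: x3 - a *: x1) + s w2 * (g *: x3 - b *: x2) = 0.
  rewrite !mulrBr addrACA -opprD -e2 w3E rmorphD /= !linearZ_LR mulrDl /=.
  by rewrite -!scalerAl -!scalerAr subrr.
have /subr0_eq X0 : f *: x3 - a *: x1 = 0.
  apply: (mulfI det0); rewrite mulr0; move: (f *: x3 - _) (g *: x3 - _) e1' e2'.
  move=> X Y e1' e2'; transitivity
   (s w2 * (w1 * X + w2 * Y) - w2 * (s w1 * X + s w2 * Y)); first by ring.
  by rewrite e1' e2' !mulr0 subr0.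
have /subr0_eq Y0 : g *: x3 - b *: x2 = 0.
  move/eqP: e1'; rewrite X0 subrr mulr0 add0r mulf_eq0 (negbTE w20) /=.
  by move/eqP.
have l1 : J (w1 * x3) (s w1 * x3) \in l.
  have -> : x3 = (f^-1 * a) *: x1 by rewrite -scalerA -X0 scalerA mulVf // scale1r.
  by rewrite -!scalerAr JZ -v1J memvZ.
have l2 : J (w2 * x3) (s w2 * x3) \in l.
  have -> : x3 = (g^-1 * b) *: x2 by rewrite -scalerA -Y0 scalerA mulVf // scale1r.
  by rewrite -!scalerAr JZ -v2J memvZ.
apply/meetsP; exists (J (w * x3) (s w * x3)); split.
- by apply/eqP => /J_eq0[/eqP]; rewrite mulf_eq0 (negbTE w0) (negbTE x30).
- have [t [r ->]] := wE w wc.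
  rewrite rmorphD /= !linearZ_LR !mulrDl -!scalerAl JD !JZ.
  by apply/memvD/memvZ/l2/memvZ.
by apply/mem_spread_member; exists x3.
Qed.

Lemma subline_two_regulus c : c != 0 -> two_regulus #|F| (subline_regulus c).
Proof.
move=> c0; split; first exact: card_subline_regulus.
- by move=> _ [w [w0 _] <-]; apply: dim_spread_member.
- move=> _ _ [w [w0 _] <-] [w' [w0' _] <-] ww'; apply: contrapT => /meetsP.
  by move=> [v [v0 vw vw']]; apply: ww'; apply: eq_spread_member v0 vw vw'.
by move=> l U1 U2 U3 dl; apply: subline_regulus_transversal.
Qed.

Definition norm1 (k : L) : Prop := k * s k * s (s k) = 1.

(** The norm is computed with s whereas the planes are graphs of r, which will be
    s or its square. *)
Definition twisted_cover (r : {lrmorphism L -> L}) : set {vspace 'rV[F]_n} :=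
  [set graph ( *%R k) r | k in norm1].

Lemma lrmorph_linear (r : {lrmorphism L -> L}) : linear r.
Proof. by move=> a x y; rewrite linearP. Qed.

Lemma mem_cover_member k (r : {lrmorphism L -> L}) v :
  v \in graph ( *%R k) r <-> exists x, v = J (k * x) (r x).
Proof. exact: (mem_graph (mulr_linear k) (lrmorph_linear r)). Qed.

Lemma dim_cover_member k (r : {lrmorphism L -> L}) :
  \dim (graph ( *%R k) r) = 3%N.
Proof.
exact: (dim_graph (mulr_linear k) (lrmorph_linear r) (fmorph_inj r)).
Qed.

Lemma norm1_neq0 k : norm1 k -> k != 0.
Proof.
by move=> Nk; apply/eqP=> k0; move/eqP: Nk; rewrite k0 !mul0r eq_sym oner_eq0.
Qed.

(** Hilbert's theorem 90 gives y with s(y) = y s(k). The substitution x = u y / k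
    then turns (k x, s(x)) into (u y, s(u) y). *)
Lemma cover_member_homothety k : norm1 k -> exists2 y, y != 0 &
  forall v, v \in graph ( *%R k) s <-> exists u, v = J (u * y) (s u * y).
Proof.
move=> Nk; have k0 := norm1_neq0 Nk.
have [|y y0 sy] := cubic_Hilbert90 (k := s k) cub.
  by rewrite s3 -Nk; ring.
exists y => // v; rewrite mem_cover_member.
have sk0 := automorph_neq0 s k0.
split=> -[x ->].
  exists (k * x / y); rewrite !rmorphM fmorphV /= sy.
  by congr J; field; rewrite ?y0 ?sk0.
exists (x * y / k); rewrite !rmorphM fmorphV /= sy.
by congr J; field.
Qed.

Lemma cover_disjoint (r : {lrmorphism L -> L}) k k' v : v != 0 ->
  v \in graph ( *%R k) r -> v \in graph ( *%R k') r -> k = k'.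
Proof.
move=> v0 /mem_cover_member[x vx] /mem_cover_member[x' vx'].
have [e /fmorph_inj xx'] := J_inj (etrans (esym vx) vx').
apply: (@mulIf _ x); last by rewrite e xx'.
by apply: contra v0 => /eqP x0; rewrite vx x0 rmorph0 mulr0 J0.
Qed.

Lemma mem_section_by (R : set {vspace 'rV[F]_n}) U p : p != 0 ->
  section_by R U <[p]>%VS <-> p \in U /\ exists2 W, R W & p \in W.
Proof.
move=> p0; rewrite /section_by /points_of /= -memvE dim_vline p0.
split=> [[[_ pU] [W RW]]|[pU [W RW pW]]]; first by rewrite -memvE; split=> //; exists W.
by split=> //; exists W => //; rewrite -memvE.
Qed.

Lemma section_set_eq (R X : set {vspace 'rV[F]_n}) (U : {vspace 'rV[F]_n}) :
  (forall P, X P -> \dim P = 1%N) ->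
  (forall p, p != 0 ->
     X <[p]>%VS <-> p \in U /\ exists2 W, R W & p \in W) ->
  section_by R U = X.
Proof.
move=> X1 XP; apply/seteqP; split=> P.
  by move=> sP; have /dim1P[p p0 PE] := sP.1.1; move: sP;
    rewrite PE => /(mem_section_by _ _ p0)/XP; apply.
by move=> xP; have /dim1P[p p0 PE] := X1 _ xP; move: xP;
  rewrite PE => /(XP _ p0)/mem_section_by; apply.
Qed.

Lemma mem_subline_regulus c v : v != 0 ->
  (exists2 W, subline_regulus c W & v \in W) <->
  exists w x, trace s (c * w) = 0 /\ v = J (w * x) (s w * x).
Proof.
move=> v0; split=> [[_ [w [_ wc] <-] /mem_spread_member[x vE]]|[w [x [wc vE]]]].
  by exists w, x.
exists (spread_member w); last by apply/mem_spread_member; exists x.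
exists w => //; split=> //; apply: contra v0 => /eqP w0.
by rewrite vE w0 rmorph0 !mul0r J0.
Qed.

(** In the parametrisation (u y, s(u) y) of a plane of the cover, the point of
    parameter u lies on the spread element of parameter w exactly when u and w
    are proportional over F. The lines obtained are distinct because the planes
    of the cover are disjoint. *)
Lemma cover_meets_in_lines c : c != 0 ->
  meets_in_distinct_lines (subline_regulus c) (twisted_cover s).
Proof.
move=> c0; have dH := dim_trace_kernel cub dimL c0.
have line U : exists l, twisted_cover s U -> [/\ \dim l = 2%N, (l <= U)%VS &
                          section_by (subline_regulus c) U = points_of l].
  have [[k Nk <-]|] := pselect (twisted_cover s U); last by exists 0%VS.
  have [y y0 memU] := cover_member_homothety Nk.
  pose h u := J (u * y) (s u * y).
  have h_linear : linear h.
    by move=> f u u'; rewrite /h linearP !mulrDl -!scalerAl J_linear.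
  have h_inj u : h u = 0 -> u = 0.
    by move/J_eq0 => [/eqP]; rewrite mulf_eq0 (negbTE y0) orbF => /eqP.
  exists (linfun h @: trace_kernel s c)%VS => _; split.
  - rewrite limg_dim_eq //; apply/eqP; rewrite -subv0; apply/subvP => u.
    rewrite memv_cap memv_ker memv0 linfun_linE // => /andP[_ /eqP hu].
    by apply/eqP/h_inj.
  - apply/subvP=> _ /memv_imgP[u _ ->]; rewrite linfun_linE //.
    by apply/memU; exists u.
  apply: section_set_eq => [P []//|p p0].
  rewrite mem_subline_regulus // /points_of /= dim_vline p0 -memvE.
  split=> [[_ /memv_imgP[u]]|[/memU[u pE] [w [x [wc pE']]]]].
    rewrite mem_trace_kernel // linfun_linE // => /eqP uc pE.
    by split; [apply/memU; exists u | exists u, y].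
  split=> //; apply/memv_imgP; exists u; last by rewrite linfun_linE.
  have u0 : u != 0.
    by apply: contra p0 => /eqP u0; rewrite pE u0 rmorph0 !mul0r J0.
  have [e1 e2] := J_inj (etrans (esym pE) pE').
  have w0 : w != 0.
    by apply: contra p0 => /eqP w0; rewrite pE' w0 rmorph0 !mul0r J0.
  have [f ->] := spread_member_overlap y0 w0 e1 e2.
  by rewrite mem_trace_kernel // -scalerAr traceZ wc scaler0.
have [ell ellP] := choice line; exists ell; split=> // U W TU TW eUW.
have [dl lU _] := ellP U TU; have [_ lW _] := ellP W TW.
have v0 : vpick (ell U) != 0 by rewrite vpick0 -dimv_eq0 dl.
have vU := subvP lU _ (memv_pick _).
have := subvP lW (vpick (ell U)); rewrite -eUW memv_pick => /(_ isT) vW.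
move: (vpick (ell U)) v0 vU vW => v v0.
case: TU TW => k _ <- [k' _ <-] vU vW.
by rewrite (cover_disjoint v0 vU vW).
Qed.

End Model.

(** * Conic sections *)

Section Conics.
Variables (F : finFieldType) (L : fieldExtType F) (n : nat).
Hypothesis dimL : \dim {:L} = 3%N.
Variable J : L -> L -> 'rV[F]_n.
Hypothesis J_linear : forall (f : F) x y x' y',
  J (f *: x + x') (f *: y + y') = f *: J x y + J x' y'.
Hypothesis J_eq0 : forall x y, J x y = 0 -> x = 0 /\ y = 0.
Variable s : {lrmorphism L -> L}.
Hypothesis cub : cubic_automorphism s.
Let s3 x : s (s (s x)) = x. Proof. by case: cub. Qed.

Lemma trace_mul_eq0 d : (forall x, trace s (d * x) = 0) -> d = 0.
Proof.
move=> d0; apply: contrapT => /eqP dn0.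
have [z /eqP] := cubic_independent cub 1 (oner_neq0 L).
by apply; have := d0 (d^-1 * z); rewrite mulVKf // !mul1r.
Qed.

Lemma trace_coefficient : exists phi : L -> F, forall x, trace s x = (phi x)%:A.
Proof.
have [phi phiP] := choice (fun x => fixed_scalar cub (trace_fixed cub x)).
by exists phi.
Qed.

(** Transports a quadratic form w |-> tr(c w s(w)) of L along a linear map into
    the matrix format that defines conics. *)
Lemma trace_form c (r : 'Hom('rV[F]_n, L)) : exists A : 'M[F]_n,
  forall v, (qform A v)%:A = trace s (c * (r v * s (r v))).
Proof.
have [phi phiE] := trace_coefficient.
pose e i : 'rV[F]_n := delta_mx 0 i.
exists (\matrix_(i, j) phi (c * (r (e i) * s (r (e j))))) => v.
pose T := linfun (fun x => trace s (c * x) : L).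
have TE x : T x = trace s (c * x) by apply: linfun_linE; apply: trace_linear.
have rE : r v = \sum_i v 0 i *: r (e i).
  by rewrite {1}[v]row_sum_delta linear_sum; apply: eq_bigr => i _; rewrite linearZ.
have srE : s (r v) = \sum_j v 0 j *: s (r (e j)).
  by rewrite rE linear_sum; apply: eq_bigr => j _; rewrite linearZ.
rewrite -TE srE mulr_sumr linear_sum /qform !mxE scaler_suml.
apply: eq_bigr => j _; rewrite !mxE mulr_suml scaler_suml rE mulr_suml linear_sum.
apply: eq_bigr => i _; rewrite !mxE -scalerAl -scalerAr !linearZ /= TE phiE.
by rewrite -!scalerA; congr (_ *: _); rewrite !scalerA mulrC.
Qed.

(** Nondegeneracy without a case distinction on the characteristic. If x is in the
    radical then c s(x) + s^2(c x) = 0; multiplying by x gives a + s^2(a) = 0 for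
    a = c x s(x). As a + s(a) + s^2(a) = 0 as well, s(a) = 0. *)
Lemma trace_form_singular c x : c != 0 -> trace s (c * (x * s x)) = 0 ->
  (forall y, trace s (c * (x * s y + y * s x)) = 0) -> x = 0.
Proof.
move=> c0 Qx polar.
have d0 : c * s x + s (s (c * x)) = 0.
  apply: trace_mul_eq0 => y; rewrite -(polar y) mulrDl mulrDr !(rmorphM, rmorphD).
  rewrite /trace !(rmorphM, rmorphD) /= !s3.
  by move: (s (s c)) (s (s x)) (s (s y)) (s c) (s x) (s y) => *; ring.
have a0 : s (c * (x * s x)) = 0.
  have : c * (x * s x) + s (s (c * (x * s x))) = 0.
    transitivity (x * (c * s x + s (s (c * x)))); last by rewrite d0 mulr0.
    by rewrite !rmorphM /= s3; move: (s (s c)) (s (s x)) (s x) => *; ring.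
  by move: Qx; rewrite /trace addrAC => + e; rewrite e add0r.
move/eqP: a0; rewrite fmorph_eq0 !mulf_eq0 fmorph_eq0 (negbTE c0) orbb /=.
by move/eqP.
Qed.

(** A point (u z, s^2(u) z) equals some (w x, s(w) x) exactly when
    u s(w) = s^2(u) w, which says that w / (u s(u)) is fixed by s. The condition
    tr(c w) = 0 thus becomes tr(c u s(u)) = 0. *)
Lemma cover_sqr_meets_in_conics c : c != 0 ->
  meets_in_conics (subline_regulus J s c) (twisted_cover J s (s \o s)).
Proof.
move=> c0 _ [k Nk <-]; split.
  exact: dim_cover_member.
have Nk' : norm1 (s \o s) k by rewrite /norm1 -Nk /= s3; ring.
have [z z0 memU] :=
  cover_member_homothety J_linear (cubic_automorphism_sqr cub) Nk'.
set U := graph _ _ _ in memU *.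
pose h u := J (u * z) (s (s u) * z).
have h_linear : linear h.
  by move=> f u u'; rewrite /h !linearP !mulrDl -!scalerAl J_linear.
have h_eq0 u : h u = 0 -> u = 0.
  by move/J_eq0 => [/eqP]; rewrite mulf_eq0 (negbTE z0) orbF => /eqP.
have hE := linfun_linE h_linear.
have hK u : (linfun h)^-1%VF (h u) = u.
  rewrite -hE lker0_lfunK // -subv0; apply/subvP => v.
  by rewrite memv_ker hE memv0 => /eqP/h_eq0/eqP.
have hD u u' : h (u + u') = h u + h u'.
  by have := h_linear 1 u u'; rewrite !scale1r.
have [A AE] := trace_form c (linfun h)^-1%VF.
have AhE u : (qform A (h u))%:A = trace s (c * (u * s u)) by rewrite AE hK.
exists A.
  move=> _ /memU[u ->] Qu polar; suff -> : u = 0.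
    by rewrite /= !rmorph0 !mul0r (J0 J_linear).
  apply: (@trace_form_singular c) => // [|y]; first by rewrite -AhE Qu scale0r.
  have hyU : h y \in U by apply/memU; exists y.
  have := polar (h y) hyU; rewrite (_ : J _ _ + _ = h (u + y)); last by rewrite hD.
  move/(congr1 (in_alg L)); rewrite !rmorphD /= !AhE => e.
  rewrite -[RHS](subrr (trace s (c * (u * s u)) + trace s (c * (y * s y)))) -{1}e.
  by rewrite /trace !(rmorphM, rmorphD) /=; ring.
have section p : p != 0 ->
    p \in U /\ (exists2 W, subline_regulus J s c W & p \in W) <->
    p \in U /\ qform A p = 0.
  move=> p0; rewrite mem_subline_regulus //.
  split=> -[pU H]; split=> //; move/memU: pU => /= [u pE].
    have u0 : u != 0.
      by apply: contra p0 => /eqP u0; rewrite pE u0 !rmorph0 !mul0r J0.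
    have [w [x [wc pE']]] := H.
    have [e1 e2] := J_inj J_linear J_eq0 (etrans (esym pE) pE').
    have su0 := automorph_neq0 s u0.
    have x0 : x != 0.
      by apply: contra p0 => /eqP x0; rewrite pE' x0 !mulr0 J0.
    have [||f us] := @eq_ratio _ _ s cub (u * s u) w.
    - by apply: contra p0 => /eqP w0; rewrite pE' w0 rmorph0 !mul0r J0.
    - apply: (mulIf z0); apply: (mulIf x0); rewrite rmorphM /=.
      transitivity (s u * (u * z) * (s w * x)); first by ring.
      by rewrite e1 -e2; ring.
    apply: (fmorph_inj (in_alg L)); rewrite /= scale0r pE AhE us.
    by rewrite -scalerAr traceZ wc scaler0.
  have u0 : u != 0.
    by apply: contra p0 => /eqP u0; rewrite pE u0 !rmorph0 !mul0r J0.
  have su0 := automorph_neq0 s u0.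
  exists (u * s u), (z / s u); rewrite -AhE -/(h u) /h -pE H scale0r; split=> //.
  by rewrite pE rmorphM /=; congr J; field.
apply: section_set_eq => [_ [u [_ u0 _] <-]|p p0]; first by rewrite dim_vline u0.
rewrite section //; split=> [[u [uU u0 Qu] up]|[pU Qp]]; last by exists p.
have /vlineP[f ->] : p \in <[u]>%VS by rewrite up memv_line.
split; first exact: memvZ.
rewrite /qform -scalemxAl linearZ -scalemxAr -scalemxAl mxE mxE.
by rewrite -/(qform A u) Qu !mulr0.
Qed.

End Conics.

(** * The Frobenius map and Lagrange interpolation at a conjugate triple *)

Section Frobenius.
Variables (F : finFieldType) (L : fieldExtType F).

Definition frob (x : L) : L := x ^+ #|F|.

HB.instance Definition _ :=
  GRing.isLinear.Build F L L *:%R frob (@frobenius_linear F L).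

Lemma frob_monoid_morphism : monoid_morphism frob.
Proof. by split=> [|x y]; rewrite /frob ?expr1n ?exprMn. Qed.

HB.instance Definition _ :=
  GRing.isMonoidMorphism.Build L L frob frob_monoid_morphism.

Lemma frob_fixed (x : L) : frob x = x -> exists f : F, x = f%:A.
Proof.
move=> fx; have : x \in 1%AS by rewrite Fermat's_little_theorem dimv1 expn1; apply/eqP.
by move/vlineP.
Qed.

Lemma frob_cube (x : L) : \dim {:L} = 3%N -> frob (frob (frob x)) = x.
Proof.
move=> dimL; have := memvf x; rewrite (Fermat's_little_theorem {:L}%AS) dimL.
by move=> /eqP; rewrite /frob -!exprM !expnS expn0 muln1 mulnA.
Qed.

Variable tau : L.
Hypothesis tau_prim : (#|F| ^ 3).-1.-primitive_root tau.

(** Otherwise the order q^3 - 1 of tau would divide q - 1. *)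
Lemma primitive_frob_moved : frob tau <> tau.
Proof.
have q1 := finNzRing_gt1 F.
rewrite /frob -[#|F|]prednK; last exact: ltnW.
rewrite exprSr => e.
have t0 : tau != 0.
  apply/eqP=> t0; have /eqP := prim_expr_order tau_prim.
  rewrite t0 expr0n -[_ == 0%N]/(_) eqn0Ngt (prim_order_gt0 tau_prim).
  by rewrite eq_sym oner_eq0.
have /eqP : tau ^+ #|F|.-1 = 1 by apply: (mulIf t0); rewrite e mul1r.
rewrite -(prim_order_dvd tau_prim) => /dvdn_leq; rewrite -subn1 subn_gt0 q1.
move/(_ isT); rewrite -subn1 leq_subLR subnKC ?(ltnW q1) //.
by apply/negP; rewrite -ltnNge -{1}[#|F|]expn1 ltn_exp2l.
Qed.

Lemma cubic_frob : \dim {:L} = 3%N -> cubic_automorphism frob.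
Proof.
move=> dimL; split; first by move=> x; apply: frob_cube.
  exact: frob_fixed.
by exists tau; apply: primitive_frob_moved.
Qed.

End Frobenius.

Section Coordinates.
Variables (F : finFieldType) (L : fieldExtType F).
Hypothesis dimL : \dim {:L} = 3%N.
Variables (s : {lrmorphism L -> L}) (tau : L).
Hypothesis cub : cubic_automorphism s.
Hypothesis moved : s tau <> tau.
Let s3 x : s (s (s x)) = x. Proof. by case: cub. Qed.

Lemma conj_distinct :
  [/\ tau - s tau != 0, tau - s (s tau) != 0 & s tau - s (s tau) != 0].
Proof.
have m1 : tau != s tau by apply/eqP => e; apply: moved.
split; rewrite subr_eq0 // ?fmorph_eq //.
by apply/eqP => e; apply: moved; rewrite {1}e s3.
Qed.

(** The coefficients of the Lagrange polynomial (X - t1)(X - t2) normalised to the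
    value 1 at t0, where t0, t1, t2 are the conjugates of tau. Its images under s
    are the two other Lagrange polynomials. *)
Definition lagrange : 'rV[L]_3 :=
  ((tau - s tau) * (tau - s (s tau)))^-1 *:
   \row_i nth 0 [:: s tau * s (s tau); - s tau - s (s tau); 1] i.

Lemma unbracketE u :
  unbracket tau u = (u 0 0)%:A + (u 0 1)%:A * tau + (u 0 (2%:R))%:A * (tau * tau).
Proof.
rewrite /unbracket !big_ord_recl big_ord0 /= addr0 addrA expr0 expr1 expr2.
rewrite !mulr_algl; congr (_ + _ *: _ + _ *: _); congr (u 0 _); exact: val_inj.
Qed.

(** Lagrange interpolation of the polynomial u0 + u1 X + u2 X^2, whose values at
    the conjugates of tau are the conjugates of its value [unbracket tau u]. *)
Lemma lagrangeE u :
  map_mx (in_alg L) u = unbracket tau u *: lagrange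
    + s (unbracket tau u) *: map_mx s lagrange
    + s (s (unbracket tau u)) *: map_mx s (map_mx s lagrange).
Proof.
have [d1 d2 d3] := conj_distinct.
rewrite unbracketE; apply/rowP => i; rewrite !mxE.
rewrite !(rmorphD, rmorphM, fmorphV) /= !rmorphN /= !rmorph_alg s3.
have [t1 [t2 [e0 e1 e2]]] : exists t1 t2, [/\ s tau = t1, s t1 = t2 & s t2 = tau].
  by exists (s tau), (s (s tau)).
rewrite e0 e1 in d1 d2 d3 *.
have d1' : t1 - tau != 0 by rewrite -opprB oppr_eq0.
have d2' : t2 - tau != 0 by rewrite -opprB oppr_eq0.
have d3' : t2 - t1 != 0 by rewrite -opprB oppr_eq0.
have : (u 0 i)%:A = nth 0 [:: (u 0 0)%:A; (u 0 1)%:A; (u 0 2%:R)%:A] i :> L.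
  by case: i => [[|[|[|//]]] i3] /=; congr ((u 0 _)%:A); apply: val_inj.
move=> ->; move: (u 0 0)%:A (u 0 1)%:A (u 0 2%:R)%:A => u0 u1 u2.
by case: i => [[|[|[|//]]] i3] /=;
   rewrite ?rmorph1 ?rmorphB ?rmorphN ?rmorphM /= ?e1 ?e2 ?e1 ?e2 ?e0; field;
   rewrite ?d1 ?d2 ?d3 ?d1' ?d2' ?d3'.
Qed.

Lemma unbracket_eq0 u : unbracket tau u = 0 -> u = 0.
Proof.
move=> u0; apply/rowP => i; apply: (fmorph_inj (in_alg L)).
have /rowP/(_ i) := lagrangeE u; rewrite u0 !rmorph0 !scale0r !addr0 !mxE.
by rewrite rmorph0.
Qed.

(** By interpolation an element of F^3 with zero image vanishes, so 1, tau, tau^2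
    is a basis of L. *)
Lemma bracketK : cancel (bracket tau) (unbracket tau).
Proof.
move=> x; pose b := [tuple 1; tau; tau ^+ 2].
have unbracket_row (k : 'I_3 -> F) :
    unbracket tau (\row_i k i) = \sum_(i < 3) k i *: b`_i.
  apply: eq_bigr => i _; rewrite mxE; congr (_ *: _).
  by case: i => [[|[|[|]]]].
have free_b : free b.
  apply/freeP => k; rewrite -unbracket_row => /unbracket_eq0 /rowP k0 i.
  by have := k0 i; rewrite !mxE.
have /andP[/eqP span_b _] : basis_of fullv b.
  by rewrite basisEfree free_b subvf size_tuple dimL.
rewrite unbracket_row -coord_span //; by rewrite span_b memvf.
Qed.

Lemma unbracket_neq0 u : (unbracket tau u != 0) = (u != 0).
Proof.
apply/idP/idP; apply: contra => /eqP; last by move/unbracket_eq0/eqP.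
by move=> ->; rewrite /unbracket big1 // => i _; rewrite mxE scale0r.
Qed.

(** Applying u |-> u v to the interpolation formula gives the trace form with
    coefficient c = lagrange v; if c vanished then u v = 0 for all u. *)
Lemma mulmx_trace (v : 'cV[F]_3) : v != 0 -> exists2 c, c != 0 &
  forall u, ((u *m v) 0 0)%:A = trace s (c * unbracket tau u).
Proof.
move=> v0; pose ev (w : 'rV[L]_3) := (w *m map_mx (in_alg L) v) 0 0.
have evD x y : ev (x + y) = ev x + ev y by rewrite /ev mulmxDl mxE.
have evZ t x : ev (t *: x) = t * ev x by rewrite /ev -scalemxAl mxE.
have evs x : ev (map_mx s x) = s (ev x).
  have vs : map_mx s (map_mx (in_alg L) v) = map_mx (in_alg L) v.
    by apply/matrixP => i j; rewrite !mxE rmorph_alg.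
  by rewrite /ev -{1}vs -map_mxM mxE.
have ev_map u : ev (map_mx (in_alg L) u) = ((u *m v) 0 0)%:A.
  by rewrite /ev -map_mxM mxE.
have := lagrangeE; move: lagrange => d dE.
have cE u : ((u *m v) 0 0)%:A = trace s (ev d * unbracket tau u).
  rewrite -ev_map dE !evD !evZ !evs /trace !rmorphM /=.
  by congr (_ + _ + _); rewrite mulrC.
exists (ev d) => //; apply: contra v0 => /eqP c0.
apply/eqP/colP => i; apply: (fmorph_inj (in_alg L)).
have := cE (delta_mx 0 i); rewrite c0 mul0r /trace !rmorph0 !addr0.
by rewrite -rowE !mxE rmorph0.
Qed.

(** Expanding the form on the interpolation formula gives
    tr(Q(d) m^2 + c m s(m)), with d the Lagrange row and c the polar of d and
    s(d). The row on which Q is supposed to vanish holds the coefficients of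
    (X - tau)(X - s(tau)), a multiple of s^2(d). Hence s^2(Q(d)) = 0. *)
Lemma qform_trace (A : 'M[F]_3) :
    (exists u, qform A u != 0) ->
    qform (map_mx (in_alg L) A)
      (\row_i nth 0 [:: tau * s tau; - tau - s tau; 1] i) = 0 ->
  exists2 c, c != 0 & forall u,
    (qform A u)%:A = trace s (c * (unbracket tau u * s (unbracket tau u))).
Proof.
move=> [u1 Qu1] Qw; pose B (x y : 'rV[L]_3) := (x *m map_mx (in_alg L) A *m y^T) 0 0.
have BDl x x' y : B (x + x') y = B x y + B x' y by rewrite /B !mulmxDl mxE.
have BDr x y y' : B x (y + y') = B x y + B x y'.
  by rewrite /B linearD mulmxDr mxE.
have BZl t x y : B (t *: x) y = t * B x y by rewrite /B -!scalemxAl mxE.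
have BZr t x y : B x (t *: y) = t * B x y.
  by rewrite /B linearZ -scalemxAr mxE.
have Bs x y : B (map_mx s x) (map_mx s y) = s (B x y).
  have As : map_mx s (map_mx (in_alg L) A) = map_mx (in_alg L) A.
    by apply/matrixP => i j; rewrite !mxE rmorph_alg.
  by rewrite /B -{1}As matrix.map_trmx -!map_mxM mxE.
have BE u : (qform A u)%:A = B (map_mx (in_alg L) u) (map_mx (in_alg L) u).
  by rewrite /B matrix.map_trmx -!map_mxM mxE.
pose d := lagrange.
have Bd2 : B (map_mx s (map_mx s d)) (map_mx s (map_mx s d)) = 0.
  rewrite (_ : map_mx s (map_mx s d) = s (s ((tau - s tau) * (tau - s (s tau)))^-1) *:
      (\row_i nth 0 [:: tau * s tau; - tau - s tau; 1] i)).
    by rewrite BZl BZr -/(qform _ _) [B _ _]Qw !mulr0.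
  apply/rowP => i; rewrite !mxE !rmorphM /=; congr (_ * _).
  case: i => [[|[|[|//]]] i3] /=; rewrite ?rmorph1 //.
    by rewrite !rmorphM /= !s3 mulrC.
  by rewrite !rmorphB /= !rmorphN /= !s3; ring.
have := lagrangeE; rewrite -/d; move: d Bd2 => d Bd2 dE.
have Bd : B d d = 0.
  by move: Bd2; rewrite !Bs => /eqP; rewrite !fmorph_eq0 => /eqP.
have s3d : map_mx s (map_mx s (map_mx s d)) = d.
  by apply/rowP => i; rewrite !mxE s3.
pose c := B d (map_mx s d) + B (map_mx s d) d.
have cE u : (qform A u)%:A =
    trace s (c * (unbracket tau u * s (unbracket tau u))).
  rewrite BE dE; move: (unbracket tau u) => m.
  rewrite !(BDl, BDr, BZl, BZr) /trace /c !(rmorphM, rmorphD) /= -!Bs s3d s3.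
  rewrite !Bs Bd !rmorph0.
  move: (B d (map_mx s d)) (B (map_mx s d) d) (s m) (s (s m)) => b1 b2 m1 m2.
  move: (s b1) (s b2) (B d _) (B _ d) => b3 b4 b5 b6.
  by ring.
exists c => //; apply: contra Qu1 => /eqP c0.
have := cE u1; rewrite c0 mul0r /trace !rmorph0 !addr0 => Q0.
by apply/eqP/(fmorph_inj (in_alg L)); rewrite rmorph0.
Qed.

End Coordinates.

(** * Lines of a subplane *)

Section DualLines.
Variable K : fieldType.

(** The same space as [line_of], over an arbitrary field: the lines of PG(2,q) are
    needed along with those of the extended plane. *)
Definition dual_line (u : 'rV[K]_3) : {vspace 'cV[K]_3} :=
  lker (linfun (mulmx u : 'cV[K]_3 -> 'cV[K]_1)).

Lemma mem_dual_line u (p : 'cV[K]_3) : (p \in dual_line u) = (u *m p == 0).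
Proof. by rewrite memv_ker lfunE. Qed.

Lemma dim_dual_line u : u != 0 -> \dim (dual_line u) = 2%N.
Proof.
move=> u0; set f := linfun (mulmx u : 'cV[K]_3 -> 'cV[K]_1).
have := limg_ker_dim f fullv; rewrite capfv dimvf dim_matrix.
suff -> : \dim (limg f) = 1%N by rewrite addn1 => -[].
apply/eqP; rewrite eqn_leq; apply/andP; split.
  by have := dimvS (subvf (limg f)); rewrite dimvf dim_matrix.
rewrite lt0n dimv_eq0; apply: contra u0 => /eqP img0.
apply/eqP/rowP => i.
have : f (delta_mx i 0) \in limg f by apply: memv_img; apply: memvf.
rewrite img0 memv0 lfunE /= -colE => /eqP/matrixP/(_ 0 0).
by rewrite !mxE.
Qed.

Lemma common_dual_line (v w : 'cV[K]_3) :
  exists u : 'rV[K]_3, [/\ u != 0, u *m v = 0 & u *m w = 0].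
Proof.
pose M := row_mx v w; have kM0 : kermx M != 0.
  rewrite -mxrank_eq0 mxrank_ker subn_eq0 -ltnNge.
  exact: leq_ltn_trans (rank_leq_col _) _.
have := nz_row_sub (kermx M); rewrite -nz_row_eq0 in kM0.
move: (nz_row _) kM0 => u u0 /sub_kermxP.
rewrite mul_mx_row -[X in _ = X](row_mx0) => /eq_row_mx[uv uw].
by exists u.
Qed.

End DualLines.

Section Subplanes.
Variables (F : finFieldType) (L : fieldExtType F).
Local Notation liftL := (map_mx (in_alg L)).
Implicit Types (M : 'M[L]_3) (p : 'cV[L]_3).

Lemma liftL_eq0 m n (A : 'M[F]_(m, n)) : liftL A = 0 -> A = 0.
Proof.
move=> A0; apply/matrixP => i j; apply: (fmorph_inj (in_alg L)).
by have /matrixP/(_ i j) := A0; rewrite !mxE rmorph0.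
Qed.

Lemma liftL_inj m n : injective (fun A : 'M[F]_(m, n) => liftL A).
Proof.
move=> A B /matrixP e; apply/matrixP => i j; apply: (fmorph_inj (in_alg L)).
by have := e i j; rewrite !mxE.
Qed.

Lemma liftL_proportional (v w : 'cV[F]_3) (t : L) : v != 0 ->
  liftL w = t *: liftL v -> exists2 f : F, t = f%:A & w = f *: v.
Proof.
move=> v0 e; have [i vi] : exists i, v i 0 != 0.
  apply: contrapT => no; case/eqP: v0; apply/colP => i; rewrite mxE.
  by apply: contrapT => /eqP vi; apply: no; exists i.
have tE : t = (w i 0 / v i 0)%:A.
  have := congr1 (fun A : 'cV[L]_3 => A i 0) e; rewrite !mxE /= => ei.
  have vi' : (v i 0)%:A != 0 :> L by rewrite -in_algE fmorph_eq0.
  by apply: (mulIf vi'); rewrite -ei -scalerAl mul1r scalerA mulfVK.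
exists (w i 0 / v i 0) => //; apply: liftL_inj; rewrite e tE.
by apply/matrixP => k l; rewrite !mxE /= -scalerAl mul1r scalerA.
Qed.

Lemma mem_line_of u p : (p \in line_of u) = (u *m p == 0).
Proof. exact: mem_dual_line. Qed.

Lemma mem_homography M U p : M \in unitmx ->
  (p \in homography M U) = (invmx M *m p \in U).
Proof.
move=> Mu; apply/memv_imgP/idP => [[x xU ->]|pU].
  by rewrite lfunE /= mulKmx.
by exists (invmx M *m p) => //; rewrite lfunE /= mulKVmx.
Qed.

Lemma homography_line M p : homography M <[p]> = <[M *m p]>%VS.
Proof. by rewrite /homography limg_line lfunE. Qed.

Lemma dim_homography M U : M \in unitmx -> \dim (homography M U) = \dim U.
Proof.
move=> Mu; rewrite limg_dim_eq //; apply/eqP; rewrite -subv0; apply/subvP => x.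
rewrite memv_cap memv_ker memv0 lfunE /= => /andP[_ /eqP Mx].
by rewrite -(mulKmx Mu x) Mx mulmx0.
Qed.

Lemma homography_mul M N U : homography (M *m N) U = homography M (homography N U).
Proof.
rewrite /homography -limg_comp; congr (_ @: _)%VS.
by apply/lfunP => x; rewrite comp_lfunE !lfunE /= mulmxA.
Qed.

Lemma mulmx_unit_neq0 M p : M \in unitmx -> p != 0 -> M *m p != 0.
Proof. by move=> Mu; apply: contra => /eqP e; rewrite -(mulKmx Mu p) e mulmx0. Qed.

(** Two points of PG(2,q) lie on a common line with coordinates in F, and such a
    line contains two points of PG(2,q). *)
Lemma line_of_subplaneP M l : M \in unitmx ->
  line_of_subplane (homography M @` @PG2q F L) l <->
  exists2 u : 'rV[F]_3, u != 0 & l = homography M (line_of (liftL u)).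
Proof.
move=> Mu; split=> [[dl [P [Q [[_ [v v0 <-] <-]]]]]|[u u0 ->]].
  rewrite !homography_line => -[_ [w w0 <-] <-]; rewrite !homography_line -!memvE.
  move=> PQ vl wl; have [u [u0 uv uw]] := common_dual_line v w.
  exists u => //; apply/eqP; rewrite eqEdim dim_homography // dim_dual_line; last first.
    by apply: contra u0 => /eqP/liftL_eq0/eqP.
  rewrite dl leqnn andbT; apply/subvP => p pl.
  have vw : M *m liftL w \notin <[M *m liftL v]>%VS.
    apply/negP => h; apply: PQ; apply/esym/eqP; rewrite eqEdim -memvE h /=.
    by rewrite !dim_vline !mulmx_unit_neq0 //;
       apply/negP => /eqP/liftL_eq0/eqP; apply/negP.
  have Mv0 : M *m liftL v != 0.
    by apply: mulmx_unit_neq0 => //; apply: contra v0 => /eqP/liftL_eq0/eqP.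
  have [f [g ->]] := dim2_span dl vl wl Mv0 vw pl.
  rewrite mem_homography // mem_line_of mulmxDr -!scalemxAr !mulKmx //.
  by rewrite mulmxDr -!scalemxAr -!map_mxM uv uw map_mx0 !scaler0 addr0.
have lu0 : liftL u != 0 by apply: contra u0 => /eqP/liftL_eq0/eqP.
split; first by rewrite dim_homography // dim_dual_line.
have [v [w [vu wu v0 vw]]] := dim2_pair (dim_dual_line u0).
have w0 : w != 0 by apply: contra vw => /eqP ->; rewrite mem0v.
exists (homography M <[liftL v]>%VS), (homography M <[liftL w]>%VS); split.
- by exists <[liftL v]>%VS => //; exists v.
- by exists <[liftL w]>%VS => //; exists w.
- rewrite !homography_line => e; case/negP: vw.
  have : M *m liftL w \in <[M *m liftL v]>%VS by rewrite e memv_line.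
  case/vlineP => t; rewrite scalemxAr => /(can_inj (mulKmx Mu)) => tE.
  by have [f _ ->] := liftL_proportional v0 tE; apply/memvZ/memv_line.
- rewrite homography_line -memvE mem_homography // mulKmx // mem_line_of.
  by move: vu; rewrite mem_dual_line -map_mxM => /eqP->; rewrite map_mx0.
rewrite homography_line -memvE mem_homography // mulKmx // mem_line_of.
by move: wu; rewrite mem_dual_line -map_mxM => /eqP->; rewrite map_mx0.
Qed.

Lemma mem_homography_line M (u : 'rV[F]_3) p : M \in unitmx ->
  (<[p]> <= homography M (line_of (liftL u)))%VS = (liftL u *m (invmx M *m p) == 0).
Proof. by move=> Mu; rewrite -memvE mem_homography // mem_line_of. Qed.

(** In the frame M, the points of b are those at infinity on the lines of the
    subplane whose dual coordinates satisfy Z. Both kinds of sublines have this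
    form. *)
Definition cut_by M (Z : 'rV[F]_3 -> Prop) (b : set {vspace 'cV[L]_3}) : Prop :=
  forall p, b <[p]>%VS <->
    [/\ p != 0, p \in @linf F L &
        exists u, [/\ u != 0, Z u & liftL u *m (invmx M *m p) = 0]].

Lemma splash_line M p : M \in unitmx ->
  splash (homography M @` @PG2q F L) <[p]>%VS <->
  [/\ p != 0, p \in @linf F L &
      exists2 u : 'rV[F]_3, u != 0 & liftL u *m (invmx M *m p) = 0].
Proof.
move=> Mu; rewrite /splash /points_of /= -memvE dim_vline.
split=> [[[p1 pl] [l /(line_of_subplaneP _ Mu)[u u0 ->]]]|[p0 pl [u u0 up]]].
  rewrite mem_homography_line // => /eqP up.
  by split=> //; [case: eqP p1 | exists u].
rewrite p0; split=> //; exists (homography M (line_of (liftL u))).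
  by apply/line_of_subplaneP => //; exists u.
by rewrite mem_homography_line // up.
Qed.

Lemma pencil_cut_by M b : M \in unitmx ->
  pencil_subline (homography M @` @PG2q F L) b ->
  exists2 v : 'cV[F]_3, v != 0 & cut_by M (fun u => u *m v = 0) b.
Proof.
move=> Mu [_ [_ [v v0 <-] <-] ->]; exists v => // p.
have Av u : (homography M <[liftL v]> <= homography M (line_of (liftL u)))%VS <->
    u *m v = 0.
  rewrite homography_line mem_homography_line // mulKmx // -map_mxM.
  by split=> [/eqP/liftL_eq0|->]; rewrite ?map_mx0.
split=> [[/(splash_line _ Mu)[p0 pl _] [l [/(line_of_subplaneP _ Mu)[u u0 ->]]]]|].
  move=> /Av uv; rewrite mem_homography_line // => /eqP up.
  by split=> //; exists u.
move=> [p0 pl [u [u0 uv up]]]; split.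
  by apply/(splash_line _ Mu); split=> //; exists u.
exists (homography M (line_of (liftL u))); split.
- by apply/line_of_subplaneP => //; exists u.
- exact/Av.
by rewrite mem_homography_line // up.
Qed.

End Subplanes.

(** * Change of frame and dual conics *)

Lemma qform_mul (K : fieldType) n (A G : 'M[K]_n) u :
  qform (G *m A *m G^T) u = qform A (u *m G).
Proof. by rewrite /qform trmx_mul !mulmxA. Qed.

Lemma qformZ (K : fieldType) n (A : 'M[K]_n) t u :
  qform A (t *: u) = t * (t * qform A u).
Proof. by rewrite /qform -scalemxAl linearZ -scalemxAr -scalemxAl mxE mxE. Qed.

Section Frames.
Variables (F : finFieldType) (L : fieldExtType F).
Local Notation liftL := (map_mx (in_alg L)).
Implicit Types (M N : 'M[L]_3) (p : 'cV[L]_3).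

(** The fundamental theorem for frames. The matrix P = N^-1 M maps the columns of
    the identity to multiples lam_i g_i of vectors over F; as the image of the
    all-one vector is also a multiple of a vector over F, the lam_i are
    proportional to elements of F. *)
Lemma subplane_frame M N : M \in unitmx -> N \in unitmx ->
    homography M @` @PG2q F L = homography N @` @PG2q F L ->
  exists t (G : 'M[F]_3), [/\ t != 0, G \in unitmx & M = t *: (N *m liftL G)].
Proof.
move=> Mu Nu MN; pose P := invmx N *m M.
have Pu : P \in unitmx by rewrite unitmx_mul unitmx_inv Nu.
have Pv (v : 'cV[F]_3) : v != 0 ->
    exists tw : L * 'cV[F]_3, P *m liftL v = tw.1 *: liftL tw.2.
  move=> v0; have : (homography N @` @PG2q F L) (homography M <[liftL v]>%VS).
    by rewrite -MN; exists <[liftL v]>%VS => //; exists v.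
  case=> _ [w w0 <-]; rewrite !homography_line => e.
  have : M *m liftL v \in <[N *m liftL w]>%VS by rewrite e memv_line.
  by case/vlineP=> t tE; exists (t, w); rewrite /P -mulmxA tE -scalemxAr mulKmx.
have delta_neq0 (i : 'I_3) : delta_mx i 0 != 0 :> 'cV[F]_3.
  by apply/eqP => /matrixP/(_ i 0)/eqP; rewrite !mxE !eqxx oner_eq0.
have [g gE] := choice (fun i => Pv _ (delta_neq0 i)).
have one_neq0 : const_mx 1 != 0 :> 'cV[F]_3.
  by apply/eqP => /matrixP/(_ 0 0)/eqP; rewrite !mxE oner_eq0.
have [[t w] /= tw] := Pv _ one_neq0.
pose Gam := \matrix_(i, j) (g j).2 i 0.
pose lam : 'cV[L]_3 := \col_j (g j).1.
have PE : P = liftL Gam *m diag_mx lam^T.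
  apply/matrixP => i j; rewrite mul_mx_diag !mxE mulrC.
  have := congr1 (fun A : 'cV[L]_3 => A i 0) (gE j).
  by rewrite map_delta_mx -colE !mxE.
have Gamu : Gam \in unitmx.
  by move: Pu; rewrite PE unitmx_mul map_unitmx => /andP[].
have lamE : lam = t *: liftL (invmx Gam *m w).
  apply: (can_inj (mulKmx (etrans (map_unitmx _ _) Gamu : liftL Gam \in unitmx))).
  rewrite -scalemxAr -map_mxM mulKVmx // -tw PE -mulmxA; congr (_ *m _).
  apply/colP => i; rewrite mul_diag_mx !mxE.
  by rewrite /= scale1r mulr1.
pose G := Gam *m diag_mx (invmx Gam *m w)^T.
have PG : P = t *: liftL G.
  rewrite PE lamE !linearZ /= /G [in RHS]map_mxM.
  by rewrite map_diag_mx matrix.map_trmx.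
have t0 : t != 0.
  apply: contraL Pu => /eqP t0; rewrite PG t0 scale0r.
  by rewrite unitmxE det0 unitr0.
exists t, G; split=> //.
  by move: Pu; rewrite PG -mul_scalar_mx unitmx_mul map_unitmx => /andP[].
by rewrite scalemxAr -PG /P mulKVmx.
Qed.

Lemma linf_delta (i : 'I_3) : i != ord_max -> delta_mx i 0 \in @linf F L.
Proof.
by move=> im; rewrite mem_line_of mul_delta_mx_0 // eq_sym.
Qed.

(** The dual coordinates of the line at infinity are (0,0,1) in the original frame,
    hence the last row of M in the frame M. *)
Lemma homography_linf M w : M \in unitmx -> @linf F L = homography M (line_of w) ->
  exists r, w = r *: row ord_max M.
Proof.
move=> Mu e; pose r := w *m invmx M; exists (r 0 ord_max).
have r0 i : i != ord_max -> r 0 i = 0.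
  move/linf_delta; rewrite e mem_homography // mem_line_of mulmxA -colE.
  by move/eqP/matrixP/(_ 0 0); rewrite !mxE.
have rE : r = r 0 ord_max *: delta_mx 0 ord_max.
  apply/rowP => i; rewrite [RHS]mxE [delta_mx _ _ _ _]mxE.
  have [->|/r0 ->] := eqVneq i ord_max.
    by rewrite mulr1.
  by rewrite mulr0.
by rewrite -(mulmxKV Mu w) -/r {1}rE -scalemxAl -rowE.
Qed.

(** The frame M = t N G of the dual conic is replaced by N through the congruence
    by G. *)
Lemma dual_conic_cut_by N b : N \in unitmx ->
    dual_conic_subline (homography N @` @PG2q F L) b ->
  exists A : 'M[F]_3,
    [/\ exists u, qform A u != 0, qform (liftL A) (row ord_max N) = 0 &
        cut_by N (fun u => qform A u = 0) b].
Proof.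
move=> Nu [D [E [[M [A [Mu MN nd -> ->]]] [w [w0 Qw] wlinf _]]] ->].
have [t [G [t0 Gu ME]]] := subplane_frame Mu Nu (esym MN).
exists (G *m A *m G^T); split.
- apply: contrapT => no; have Q0 u : qform A u = 0.
    rewrite -(mulmxKV Gu u) -qform_mul; apply: contrapT => /eqP Qu.
    by apply: no; exists (u *m invmx G).
  have /matrixP/(_ 0 0)/eqP : delta_mx 0 0 = 0 :> 'rV[F]_3.
    by apply: nd => // [|w' _]; rewrite ?memvf ?Q0 ?addr0.
  by rewrite !mxE oner_eq0.
- have [r wE] := homography_linf Mu (esym wlinf).
  have {}wE : w = (r * t) *: (row ord_max N *m liftL G).
    by rewrite wE ME linearZ /= scalerA row_mul.
  have rt0 : r * t != 0 by apply: contra w0 => /eqP rt0; rewrite wE rt0 scale0r.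
  rewrite !map_mxM -matrix.map_trmx qform_mul.
  move: Qw; rewrite wE qformZ => /eqP.
  by rewrite 2!(mulf_eq0 (r * t)) (negbTE rt0) => /eqP.
move=> p; have invE : invmx N *m p = t *: (liftL G *m (invmx M *m p)).
  by rewrite -{1}(mulKVmx Mu p) {1}ME -scalemxAl -scalemxAr -mulmxA mulKmx.
have cutE u : (liftL (u *m G) *m (invmx M *m p) == 0) =
              (liftL u *m (invmx N *m p) == 0).
  by rewrite invE -scalemxAr scaler_eq0 (negbTE t0) /= map_mxM -mulmxA.
split.
  case=> /(splash_line _ Nu)[p0 pl _] [_ [u [u0 Qu] <-]].
  rewrite mem_homography_line // => up; split=> //; exists (u *m invmx G).
  split; last by apply/eqP; rewrite -cutE mulmxKV.
    by apply: contra u0 => /eqP e; rewrite -(mulmxKV Gu u) e mul0mx.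
  by rewrite qform_mul mulmxKV.
case=> p0 pl [u [u0 Qu /eqP up]]; split.
  by apply/(splash_line _ Nu); split=> //; exists u => //; apply/eqP.
exists (homography M (line_of (liftL (u *m G)))).
  exists (u *m G) => //; split; last by rewrite -qform_mul.
  by apply: contra u0 => /eqP e; rewrite -(mulmxK Gu u) e mul0mx.
by rewrite mem_homography_line // cutE.
Qed.

End Frames.

(** * The covers of a subplane *)

Section ExplicitMatrices.
Variables (F : finFieldType) (L : fieldExtType F).

Lemma mx3_mul_col3 (m00 m01 m02 m10 m11 m12 m20 m21 m22 x y z : L) :
  mx3 [:: [:: m00; m01; m02]; [:: m10; m11; m12]; [:: m20; m21; m22]]
    *m col3 x y z =
  col3 (m00 * x + m01 * y + m02 * z) (m10 * x + m11 * y + m12 * z)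
       (m20 * x + m21 * y + m22 * z).
Proof.
apply/colP => i; rewrite !mxE !big_ord_recl big_ord0 !mxE /= addr0 addrA.
by case: i => [[|[|[|//]]]].
Qed.

Lemma col3_inj (x y z x' y' z' : L) :
  col3 x y z = col3 x' y' z' -> [/\ x = x', y = y' & z = z'].
Proof.
move=> /colP e; have := e 0; have := e 1; have := e ord_max.
by rewrite !mxE /= => -> -> ->.
Qed.

Lemma col3_eta (p : 'cV[L]_3) : p = col3 (p 0 0) (p 1 0) (p ord_max 0).
Proof.
apply/colP => i; rewrite mxE; case: i => [[|[|[|//]]] i3] /=;
  by congr (p _ 0); apply: val_inj.
Qed.

Lemma col3_0 : col3 0 0 0 = 0 :> 'cV[L]_3.
Proof. by apply/colP => i; rewrite !mxE; case: i => [[|[|[|]]]]. Qed.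

Lemma mem_linf (x y z : L) : (col3 x y z \in @linf F L) = (z == 0).
Proof.
rewrite mem_line_of -rowE; apply/eqP/eqP => [/colP/(_ 0)|->]; first by rewrite !mxE.
by apply/colP => i; rewrite !mxE.
Qed.

Variable tau : L.
Local Notation t1 := (tau ^+ #|F|).
Hypothesis moved : frob tau <> tau.

Lemma Kmx_unit : Kmx tau \in unitmx.
Proof.
rewrite -unitmx_tr unitmxE unitfE; apply/det0P => -[v v0 /(congr1 trmx)].
rewrite trmx_mul trmxK trmx0 [v^T]col3_eta mx3_mul_col3.
rewrite -col3_0.
rewrite !mul0r !mul1r !addr0; case/col3_inj => e0 e1 e2.
have z0 : v^T 0 0 = 0.
  apply/eqP; have : (t1 - tau) * v^T 0 0 == 0.
    by apply/eqP; rewrite -[RHS](subrr 0) -{1}e0 -e1; ring.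
  by rewrite mulf_eq0 subr_eq0 => /orP[/eqP/moved|].
rewrite z0 mulr0 add0r in e0; rewrite z0 e0 !mulr0 !add0r in e2.
case/eqP: v0; apply: trmx_inj; rewrite trmx0 [v^T]col3_eta z0 e0 e2.
exact: col3_0.
Qed.

End ExplicitMatrices.

Section CoverFrame.
Variables (F : finFieldType) (L : fieldExtType F).
Hypothesis dimL : \dim {:L} = 3%N.
Variable tau : L.
Hypothesis tau_prim : (#|F| ^ 3).-1.-primitive_root tau.
Variables a b c d e f : L.
Local Notation Phi := (mx3 [:: [:: a; b; e]; [:: c; d; f]; [:: 0; 0; 1]]).
Hypothesis Phi_unit : Phi \in unitmx.
Local Notation liftL := (map_mx (in_alg L)).

Let cub := cubic_frob tau_prim dimL.
Let moved := primitive_frob_moved tau_prim.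

Definition frob2 : {lrmorphism L -> L} := (@frob F L) \o (@frob F L).

(** The induced map of the hyperplane at infinity, composed with the Bruck-Bose
    map; it plays the role of J. *)
Definition bb_affine (x y : L) := bb_vec tau (a * x + b * y) (c * x + d * y).

Lemma bb_affine_linear (t : F) x y x' y' :
  bb_affine (t *: x + x') (t *: y + y') = t *: bb_affine x y + bb_affine x' y'.
Proof.
rewrite /bb_affine -bb_vec_linear.
by congr bb_vec; rewrite !mulrDr -!scalerAr scalerDr addrACA.
Qed.

Lemma bracket_eq0 x : bracket tau x = 0 -> x = 0.
Proof.
move=> x0; rewrite -(bracketK dimL cub moved x) x0 /unbracket.
by apply: big1 => i _; rewrite mxE scale0r.
Qed.

Lemma affine_eq0 x y : a * x + b * y = 0 -> c * x + d * y = 0 -> x = 0 /\ y = 0.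
Proof.
move=> e1 e2; have : Phi *m col3 x y 0 = 0.
  rewrite mx3_mul_col3 !mulr0 !addr0 e1 e2 !mul0r !addr0.
  exact: col3_0.
move/(congr1 (mulmx (invmx Phi))); rewrite mulKmx // mulmx0 => /colP z.
by have := z 0; have := z 1; rewrite !mxE.
Qed.

Lemma bb_affine_eq0 x y : bb_affine x y = 0 -> x = 0 /\ y = 0.
Proof.
rewrite /bb_affine /bb_vec -row_mx0 => /eq_row_mx[].
rewrite -row_mx0 => /eq_row_mx[e1 e2] _.
by apply: affine_eq0; apply: bracket_eq0.
Qed.

Lemma spread_planeE x y :
  spread_plane tau (a * x + b * y) (c * x + d * y) = graph bb_affine ( *%R x) ( *%R y).
Proof.
rewrite /spread_plane /sigma_plane /graph; congr (limg (linfun _)).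
by apply/funext => z; rewrite /bb_affine; congr bb_vec; ring.
Qed.

Lemma induced_bb_vec x y :
  induced tau a b c d (bb_vec tau x y) = bb_affine x y.
Proof.
by rewrite inducedE /bb_vec !row_mxKl row_mxKr /= !(bracketK dimL cub moved).
Qed.

Lemma induced_sigma_plane (k : L) (r : {lrmorphism L -> L}) :
  (induced tau a b c d @: sigma_plane tau ( *%R k) r)%VS = graph bb_affine ( *%R k) r.
Proof.
have rL : linear r by move=> t x y; rewrite linearP.
have bbL : linear (fun x => bb_vec tau (k * x) (r x)).
  by move=> t u v; rewrite rL mulr_linear bb_vec_linear.
have JL : linear (fun x => bb_affine (k * x) (r x)).
  exact: (graph_linear bb_affine_linear (mulr_linear k) rL).
rewrite /sigma_plane -limg_comp; congr (limg _); apply/lfunP => x.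
by rewrite comp_lfunE (linfun_linE bbL) (linfun_linE JL) induced_bb_vec.
Qed.

Lemma normK_norm1 (k : L) : @normK F L k <-> norm1 (@frob F L) k.
Proof.
rewrite /normK /norm1 /= /frob -exprM -exprS -exprD mulnn.
by rewrite addn1 -addnS addnC.
Qed.

Lemma cubic_frob2 : cubic_automorphism frob2.
Proof. exact: cubic_automorphism_sqr cub. Qed.

Lemma twisted_cover_eq (s s' r r' : {lrmorphism L -> L}) :
  (forall k, norm1 s k <-> norm1 s' k) -> (forall x, r x = r' x) ->
  twisted_cover bb_affine s r = twisted_cover bb_affine s' r'.
Proof.
move=> ss' rr'; have E k : graph bb_affine ( *%R k) r = graph bb_affine ( *%R k) r'.
  by congr graph; apply/funext.
by apply/seteqP; split=> _ [k /ss' Nk <-]; exists k.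
Qed.

Lemma norm1_frob2 k : norm1 frob2 k <-> norm1 (@frob F L) k.
Proof. by rewrite /norm1 /frob2 /= (frob_cube _ dimL) mulrAC. Qed.

Lemma tangent_coverE :
  [set (induced tau a b c d @: tangent_plane tau k)%VS | k in @normK F L] =
  twisted_cover bb_affine (@frob F L) (@frob F L).
Proof.
apply/seteqP; split=> _ [k Nk <-]; exists k; try exact/normK_norm1.
  by rewrite -induced_sigma_plane.
by rewrite -induced_sigma_plane.
Qed.

Lemma conic_coverE :
  [set (induced tau a b c d @: conic_plane tau k)%VS | k in @normK F L] =
  twisted_cover bb_affine (@frob F L) frob2.
Proof.
have E k : conic_plane tau k = sigma_plane tau ( *%R k) frob2.
  rewrite /conic_plane; congr sigma_plane; apply/funext => x.
  by rewrite /frob2 /= /frob -exprM.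
by apply/seteqP; split=> _ [k Nk <-]; exists k; try exact/normK_norm1;
   rewrite E induced_sigma_plane.
Qed.

(** The matrix [Kmx] sends (1, tau, tau^2) to (0, tau - tau^q, 0) and its conjugate
    (1, tau^q, tau^2q) to (tau^q - tau, 0, 0). So (x, y, 0) comes, up to a
    scalar, from the vector r equal to x times the conjugate minus y times the
    first; and u r is obtained from the values of u at tau and tau^q. *)
Lemma incidence u x y :
  (liftL u *m (invmx (Phi *m Kmx tau) *m col3 (a * x + b * y) (c * x + d * y) 0) = 0)
  <-> x * frob (unbracket tau u) = y * unbracket tau u.
Proof.
have Nu : Phi *m Kmx tau \in unitmx by rewrite unitmx_mul Phi_unit Kmx_unit.
have d0 : frob tau - tau != 0 by rewrite subr_eq0; apply/eqP.
set t1 := frob tau in d0 *.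
pose r := col3 (x - y) (x * t1 - y * tau) (x * (t1 * t1) - y * (tau * tau)).
have rE : Phi *m Kmx tau *m r = (t1 - tau) *: col3 (a * x + b * y) (c * x + d * y) 0.
  rewrite -mulmxA /r !mx3_mul_col3 -/(frob tau) -/t1.
  apply/colP => i; rewrite !mxE.
  by case: i => [[|[|[|//]]] i3] /=; ring.
have uE : (liftL u *m r) 0 0 = x * frob (unbracket tau u) - y * unbracket tau u.
  rewrite (unbracketE tau u) !(rmorphD, rmorphM) /= !rmorph_alg -/t1.
  rewrite !mxE !big_ord_recl big_ord0 !mxE /=.
  have -> : lift ord0 (lift ord0 ord0) = 2%:R :> 'I_3 by apply: val_inj.
  have -> : lift ord0 ord0 = 1 :> 'I_3 by apply: val_inj.
  move: (u 0 0)%:A (u 0 1)%:A (u 0 2%:R)%:A => u0 u1 u2.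
  by ring.
have -> : invmx (Phi *m Kmx tau) *m col3 (a * x + b * y) (c * x + d * y) 0 =
    (t1 - tau)^-1 *: r.
  by rewrite -(mulKmx Nu r) rE -scalemxAr scalerA mulVf // scale1r.
rewrite -scalemxAr; split=> [/matrixP/(_ 0 0)/eqP|xy].
  by rewrite mxE uE mxE mulf_eq0 invr_eq0 (negbTE d0) subr_eq0 => /eqP.
by apply/matrixP => i j; rewrite !ord1 mxE uE xy subrr mulr0 mxE.
Qed.

Lemma linf_affine (X Y : L) : exists x y,
  X = a * x + b * y /\ Y = c * x + d * y.
Proof.
have := mulKVmx Phi_unit (col3 X Y 0); rewrite [invmx _ *m _]col3_eta.
set x := _ 0 0; set y := _ 1 0; set z := _ ord_max 0.
rewrite mx3_mul_col3 => /col3_inj[<- <-]; rewrite !mul0r !add0r mul1r => ->.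
by exists x, y; rewrite !mulr0 !addr0.
Qed.

(** The plane of the spread depends only on the point (x, y, 0). *)
Lemma graph_scale (k x y : L) : k != 0 ->
  graph bb_affine ( *%R (k * x)) ( *%R (k * y)) = graph bb_affine ( *%R x) ( *%R y).
Proof.
move=> k0; have memG x' y' v : v \in graph bb_affine ( *%R x') ( *%R y') <->
    exists z, v = bb_affine (x' * z) (y' * z).
  exact: (mem_graph bb_affine_linear (mulr_linear x') (mulr_linear y') v).
apply/vspaceP => v; apply/idP/idP => /memG[z ->]; apply/memG.
  by exists (k * z); congr bb_affine; ring.
by exists (k^-1 * z); congr bb_affine; field.
Qed.

(** By [incidence] the line u meets the line at infinity in the point
    (m, m^q, 0), up to the homography, where m = [unbracket tau u]. *)
Lemma bb_set_cut_by Z b' : cut_by (Phi *m Kmx tau) Z b' ->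
  bb_set tau b' =
  [set spread_member bb_affine (@frob F L) (unbracket tau u)
    | u in [set u | u != 0 /\ Z u]].
Proof.
move=> cutb; apply/seteqP.
split=> [U [X [Y [/cutb[p0 _ [u [u0 Zu uE]]] ->]]]|_ [u [u0 Zu] <-]].
  have [x [y [XE YE]]] := linf_affine X Y; rewrite XE YE in p0 uE *.
  move/incidence: uE => xy; have m0 : unbracket tau u != 0.
    by rewrite (unbracket_neq0 cub moved).
  rewrite spread_planeE; exists u => //; rewrite /spread_member.
  have x0 : x != 0.
    apply: contra p0 => /eqP x0; move/eqP: xy; rewrite x0 mul0r eq_sym mulf_eq0.
    rewrite (negbTE m0) orbF => /eqP ->.
    by rewrite !mulr0 !addr0; apply/eqP/col3_0.
  rewrite -(@graph_scale (x / unbracket tau u)) ?mulf_neq0 ?invr_eq0 //.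
  by rewrite mulfVK // mulrAC xy mulfK.
have m0 : unbracket tau u != 0 by rewrite (unbracket_neq0 cub moved).
set m := unbracket tau u in m0 *.
exists (a * m + b * frob m), (c * m + d * frob m); split; last by rewrite spread_planeE.
apply/cutb; split; last by exists u; split=> //; apply/incidence; rewrite mulrC.
  apply: contra m0; rewrite -col3_0 => /eqP/col3_inj[e1 e2 _].
  by have [-> _] := affine_eq0 e1 e2.
by rewrite mem_linf.
Qed.

Lemma bb_pencil_subline b' : pencil_subline (homography Phi @` Bplane tau) b' ->
  exists2 k, k != 0 & bb_set tau b' = subline_regulus bb_affine (@frob F L) k.
Proof.
have Nu : Phi *m Kmx tau \in unitmx by rewrite unitmx_mul Phi_unit Kmx_unit.
have -> : homography Phi @` Bplane tau = homography (Phi *m Kmx tau) @` @PG2q F L.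
  rewrite /Bplane image_comp; apply: eq_imagel => U _.
  by rewrite homography_mul.
move/(pencil_cut_by Nu) => [v v0 /bb_set_cut_by ->].
have [k k0 kE] := mulmx_trace cub moved v0; exists k => //.
have uvE u : u *m v = 0 <-> trace (@frob F L) (k * unbracket tau u) = 0.
  rewrite -kE; split=> [->|/eqP]; first by rewrite mxE scale0r.
  rewrite scaler_eq0 oner_eq0 orbF => /eqP uv.
  by apply/matrixP => i j; rewrite !ord1 uv mxE.
apply/seteqP; split=> [_ [u [u0 /uvE uv] <-]|_ [w [w0 wk] <-]].
  by exists (unbracket tau u) => //; split=> //; rewrite (unbracket_neq0 cub moved).
exists (bracket tau w); last by rewrite (bracketK dimL cub moved).
split; last by apply/uvE; rewrite (bracketK dimL cub moved).
by apply: contra w0 => /eqP/bracket_eq0 ->.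
Qed.

(** Rescaling (m, m^q) by the conjugate of m of exponent q^2 turns it into
    (w, w^(q^2)) with w = m m^(q^2), and the condition tr(c m m^q) = 0 into a
    linear one on w. Conversely m = w w^q gives back w up to its norm. *)
Lemma bb_dual_conic_subline b' :
  dual_conic_subline (homography Phi @` Bplane tau) b' ->
  exists2 k, k != 0 & bb_set tau b' = subline_regulus bb_affine frob2 k.
Proof.
have Nu : Phi *m Kmx tau \in unitmx by rewrite unitmx_mul Phi_unit Kmx_unit.
have -> : homography Phi @` Bplane tau = homography (Phi *m Kmx tau) @` @PG2q F L.
  rewrite /Bplane image_comp; apply: eq_imagel => U _.
  by rewrite homography_mul.
move/(dual_conic_cut_by Nu) => [A [A0 Aw /bb_set_cut_by ->]].
have {}Aw : qform (liftL A) (\row_i nth 0 [:: tau * frob tau; - tau - frob tau; 1] i) = 0.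
  rewrite -[RHS]Aw; congr qform; apply/rowP => i.
  rewrite !mxE !big_ord_recl big_ord0 !mxE /=.
  by rewrite !mul0r !add0r mul1r addr0.
have [k k0 kE] := qform_trace cub moved A0 Aw.
exists (frob2 k); first by rewrite fmorph_eq0.
have f3 x : frob (frob (frob x)) = x := frob_cube x dimL.
have QuE u : qform A u = 0 <->
    trace (@frob F L) (k * (unbracket tau u * frob (unbracket tau u))) = 0.
  rewrite -kE; split=> [->|/eqP]; first by rewrite scale0r.
  by rewrite scaler_eq0 oner_eq0 orbF => /eqP.
have tr2 x : trace frob2 x = trace (@frob F L) x.
  by rewrite /trace /frob2 /= f3 addrAC.
have fn0 (x : L) : x != 0 -> frob x != 0 by rewrite fmorph_eq0.
apply/seteqP; split=> [_ [u [u0 /QuE uv] <-]|_ [w [w0 wk] <-]].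
  have m0 : unbracket tau u != 0 by rewrite (unbracket_neq0 cub moved).
  move: (unbracket tau u) m0 uv => m m0 uv.
  exists (m * frob2 m).
    split; first by rewrite mulf_neq0 ?fmorph_eq0.
    rewrite tr2 -(trace_shift cub) -uv; congr trace.
    by rewrite /frob2 /= !rmorphM /= !f3; ring.
  rewrite /spread_member -[RHS](@graph_scale (frob2 m)) ?fmorph_eq0 //.
  by rewrite /frob2 /= !rmorphM /= f3 (mulrC m).
have mE : unbracket tau (bracket tau (w * frob w)) = w * frob w.
  exact: (bracketK dimL cub moved).
(* With m = w w^q, the product m m^(q^2) is the norm of w times w. *)
exists (bracket tau (w * frob w)).
  split; first by rewrite -(unbracket_neq0 cub moved) mE mulf_neq0 ?fn0.
  apply/QuE; rewrite mE.
  have {}wk : trace (@frob F L) (k * frob w) = 0.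
    by rewrite -[RHS]wk tr2 -[RHS](trace_shift cub) /frob2 !rmorphM /= f3.
  have [t tE] : exists t : F, w * frob w * frob (frob w) = t%:A.
    by apply: frob_fixed; rewrite !rmorphM /= f3 mulrC mulrA.
  have -> : k * (w * frob w * frob (w * frob w)) = t *: (k * frob w).
    by rewrite -(mulr_algl t) -tE !rmorphM /=; ring.
  by rewrite traceZ wk scaler0.
rewrite mE /spread_member -[RHS](@graph_scale (frob w)) ?fn0 //.
by rewrite (mulrC w) rmorphM /= (mulrC (frob (frob w))) /frob2 /= mulrC.
Qed.

(** Both covers are taken here in one and the same frame; as the planes of T and of
    C are treated separately, each may use its own frame in the end. *)
Lemma pencil_subline_sections b' :
  pencil_subline (homography Phi @` Bplane tau) b' ->
  [/\ two_regulus #|F| (bb_set tau b'),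
      meets_in_distinct_lines (bb_set tau b')
        [set (induced tau a b c d @: tangent_plane tau k)%VS | k in @normK F L] &
      meets_in_conics (bb_set tau b')
        [set (induced tau a b c d @: conic_plane tau k)%VS | k in @normK F L]].
Proof.
case/bb_pencil_subline => k k0 ->; rewrite tangent_coverE conic_coverE; split.
- exact: (subline_two_regulus dimL bb_affine_linear bb_affine_eq0 cub k0).
- exact: (cover_meets_in_lines dimL bb_affine_linear bb_affine_eq0 cub k0).
- exact: (cover_sqr_meets_in_conics dimL bb_affine_linear bb_affine_eq0 cub k0).
Qed.

Lemma dual_conic_subline_sections b' :
  dual_conic_subline (homography Phi @` Bplane tau) b' ->
  [/\ two_regulus #|F| (bb_set tau b'),
      meets_in_conics (bb_set tau b')
        [set (induced tau a b c d @: tangent_plane tau k)%VS | k in @normK F L] &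
      meets_in_distinct_lines (bb_set tau b')
        [set (induced tau a b c d @: conic_plane tau k)%VS | k in @normK F L]].
Proof.
case/bb_dual_conic_subline => k k0 ->; rewrite tangent_coverE conic_coverE; split.
- exact: (subline_two_regulus dimL bb_affine_linear bb_affine_eq0 cubic_frob2 k0).
- rewrite (@twisted_cover_eq (@frob F L) frob2 (@frob F L) (frob2 \o frob2)).
  + exact: (cover_sqr_meets_in_conics dimL bb_affine_linear bb_affine_eq0 cubic_frob2 k0).
  + by move=> k'; rewrite norm1_frob2.
  + by move=> x; rewrite /frob2 /= (frob_cube _ dimL).
rewrite (@twisted_cover_eq (@frob F L) frob2 frob2 frob2) //.
  exact: (cover_meets_in_lines dimL bb_affine_linear bb_affine_eq0 cubic_frob2 k0).
by move=> k'; rewrite norm1_frob2.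
Qed.

End CoverFrame.

Theorem theorem7p1 (F : finFieldType) (L : fieldExtType F)
    (dimL : \dim {:L} = 3%N)
    (tau : L) (tau_prim : (#|F| ^ 3).-1.-primitive_root tau)
    (pi : set {vspace 'cV[L]_3})
    (pi_subplane : order_q_subplane pi) (pi_ext : exterior pi)
    (T C : set {vspace 'rV[F]_(3 + 3 + 1)})
    (T_cover : tangent_cover tau pi T) (C_cover : conic_cover tau pi C) :
  (forall b : set {vspace 'cV[L]_3}, pencil_subline pi b ->
     [/\ two_regulus #|F| (bb_set tau b),
         meets_in_distinct_lines (bb_set tau b) T &
         meets_in_conics (bb_set tau b) C]) /\
  (forall b : set {vspace 'cV[L]_3}, dual_conic_subline pi b ->
     [/\ two_regulus #|F| (bb_set tau b),
         meets_in_conics (bb_set tau b) T &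
         meets_in_distinct_lines (bb_set tau b) C]).
Proof.
have [a [b [c [d [e [f [Phi_unit piT ->]]]]]]] := T_cover.
have [a' [b' [c' [d' [e' [f' [Phi'_unit piC ->]]]]]]] := C_cover.
split=> l lpi.
  rewrite -piT in lpi.
  have [? ? _] := pencil_subline_sections dimL tau_prim Phi_unit lpi.
  rewrite piT -piC in lpi.
  by have [] := pencil_subline_sections dimL tau_prim Phi'_unit lpi.
rewrite -piT in lpi.
have [? ? _] := dual_conic_subline_sections dimL tau_prim Phi_unit lpi.
rewrite piT -piC in lpi.
by have [] := dual_conic_subline_sections dimL tau_prim Phi'_unit lpi.
Qed.
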